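(* Let $\mathcal K\subset\Theta^*$ be the convex polyhedral cone of all real $A=(a_{i,j})_{1\le i<j\le n}$ satisfying (a) $a_{i,i+1}+a_{i+1,i+2}\le a_{i,i+2}$ for $1\le i\le n-2$ and (b) $a_{i,j}+a_{i+1,j+1}\le a_{i,j+1}+a_{i+1,j}$ for $1\le i<j-1\le n-2$. Then $\sigma(\mathcal K)$ is a cone in the Gröbner fan of the complete flag variety $F$. Moreover, $\sigma(\mathcal K)$ is a maximal cone in the tropicalization of $F$.
   Context: Fix $n\ge2$. $R=\mathbb C[\{X_{i_1,\dots,i_k}\mid 1\le k\le n-1,\ 1\le i_1<\dots<i_k\le n\}]$ is the polynomial ring in Plücker variables, the homogeneous coordinate ring of $\mathbb P=\prod_{k=1}^{n-1}\mathbb P(\wedge^k\mathbb C^n)$. $F=SL_n(\mathbb C)/B\subset\mathbb P$ is the variety of complete flags in its Plücker embedding and $I\subset R$ is the (multihomogeneous) ideal of Plücker relations defining it. For $S=(s_{i_1,\dots,i_k})\in\Xi=\mathbb R^{\{1\le i_1<\dots<i_k\le n\,|\,1\le k\le n-1\}}$ let $\mathrm{grad}^S$ be the grading on $R$ with $\mathrm{grad}^SX_{i_1,\dots,i_k}=s_{i_1,\dots,i_k}$, and $\mathrm{in}_{\mathrm{grad}^S}I$ the ideal spanned by the nonzero components of minimal grading of elements of $I$. $\Theta=\mathbb R^{\{1\le i<j\le n\}}$, and $\Theta^*$ has the dual basis, so elements of $\Theta^*$ are written $A=(a_{i,j})$. The vector $T(i_1,\dots,i_k)\in\Theta$ has coordinate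 $1$ at each pair $(l,i_l)$ with $1\le l\le k$, $i_l>l$, and all other coordinates $0$. The linear map $\sigma:\Theta^*\to\Xi$ is $\sigma(A)_{i_1,\dots,i_k}=A(T(i_1,\dots,i_k))=\sum_{i<j}a_{i,j}T(i_1,\dots,i_k)_{i,j}$. Gröbner fan and tropicalization. Let $\Xi_0\subset\Xi$ be the subspace of $S$ with $s_{1,\dots,k}=0$ for all $1\le k\le n-1$; note $\sigma(\Theta^* )\subset\Xi_0$. On $\Xi_0$ put $S\sim S'$ if and only if $\mathrm{in}_{\mathrm{grad}^S}I=\mathrm{in}_{\mathrm{grad}^{S'}}I$. Each equivalence class is the relative interior of a closed convex rational polyhedral cone, and all these cones form a complete fan in $\Xi_0$, the Gröbner fan of $F$. The cones in this fan such that for $S$ in the relative interior $\mathrm{in}_{\mathrm{grad}^S}I$ contains no monomials in the Plücker variables form a subfan, which is the tropicalization of $F$ (with respect to the zero valuation on $\mathbb C$). A maximal cone is one that is maximal with respect to inclusion in this subfan. *)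

(* Defs.v *)
From mathcomp Require Import all_boot all_order all_algebra.
From mathcomp Require Import complex.
From mathcomp Require Import classical_sets reals.
From mathcomp Require Import mpoly.

Set Implicit Arguments.
Unset Strict Implicit.
Unset Printing Implicit Defensive.

Import Order.TTheory GRing.Theory Num.Theory.

Local Open Scope ring_scope.
Local Open Scope classical_set_scope.
Local Open Scope complex_scope.

(* [R : realType] is the field of real numbers and [R[i]] that of complex     *)
(* numbers. All indices are shifted by one: {1, ..., n} becomes 'I_n.         *)

(* A tuple i_1 < ... < i_k with 1 <= k <= n - 1 is encoded by the set A of    *)
(* its entries; as [enum] lists ordinals increasingly, i_l is the value of    *)
(* [enum_val] at l : 'I_#|A|.                                                 *)
Definition pindex (n : nat) := {A : {set 'I_n} | (0 < #|A| < n)%N}.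

Definition pos (n : nat) := {p : 'I_n * 'I_n | (p.1 < p.2)%N}.

(* The polynomial ring in the Pluecker variables: the variable X_A is         *)
(* 'X_(enum_rank A).                                                          *)
Notation pring R n := {mpoly R[i][#|{: pindex n}|]}.
Notation pmonom n := 'X_{1..#|{: pindex n}|}.

Notation Xi R n := {ffun pindex n -> R}.
(* The same type serves for Theta^*, via the dual basis. *)
Notation Theta R n := {ffun pos n -> R}.

Section PlueckerIdeal.
Variables (R : realType) (n : nat).

Fact card_set_ord_le (A : {set 'I_n}) : (#|A| <= n)%N.
Proof. by rewrite -[X in (_ <= X)%N]card_ord max_card. Qed.

(* The coordinate of g e_1 /\ ... /\ g e_k at e_(i_1) /\ ... /\ e_(i_k):      *)
(* the minor of g on the rows i_1, ..., i_k and the first k columns.          *)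
Definition pcoord (g : 'M[R[i]]_n) (A : pindex n) : R[i] :=
  \det (\matrix_(r < #|val A|, c < #|val A|)
          g (enum_val r) (widen_ord (card_set_ord_le (val A)) c)).

Definition ppoint (g : 'M[R[i]]_n) : 'I_#|{: pindex n}| -> R[i] :=
  fun j => pcoord g (enum_val j).

(* Its value at k is the degree in the coordinates of P(wedge^k C^n). *)
Definition multideg (m : pmonom n) : {ffun 'I_n -> nat} :=
  [ffun k : 'I_n => (\sum_(A : pindex n | #|val A| == k) m (enum_rank A))%N].

Definition multihomog_part (d : {ffun 'I_n -> nat}) (f : pring R n) :
    pring R n :=
  \sum_(m <- msupp f | multideg m == d) f@_m *: 'X_[m].

(* The multihomogeneous ideal of F = SL_n(C)/B in the product of the          *)
(* P(wedge^k C^n): the sums of multihomogeneous polynomials vanishing on F.   *)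
Definition pideal : set (pring R n) :=
  [set f | forall (d : {ffun 'I_n -> nat}) (g : 'M[R[i]]_n), \det g = 1 ->
             (multihomog_part d f).@[ppoint g] = 0].

End PlueckerIdeal.

Section InitialIdeal.
Variables (R : realType) (n : nat).
Implicit Types (S : Xi R n).

Definition grad S (m : pmonom n) : R :=
  \sum_(A : pindex n) S A *+ m (enum_rank A).

Definition init_part S (f : pring R n) : pring R n :=
  \sum_(m <- msupp f | all (fun m' => grad S m <= grad S m') (msupp f))
    f@_m *: 'X_[m].

Definition init_ideal S : set (pring R n) :=
  [set p | exists2 s : seq (R[i] * pring R n),
             (forall x, x \in s -> pideal x.2 /\ x.2 != 0)
           & p = \sum_(x <- s) x.1 *: init_part S x.2].

Definition monomial_free (J : set (pring R n)) : Prop :=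
  forall m : pmonom n, ~ J 'X_[m].

End InitialIdeal.

Section Cones.
Variables (R : realType) (T : finType).
Implicit Types (K : set {ffun T -> R}) (x y : {ffun T -> R}).

Definition rational_cone K : Prop :=
  exists s : seq {ffun T -> int},
    K = [set x : {ffun T -> R} |
           forall c, c \in s -> 0 <= \sum_t (c t)%:~R * x t].

Definition affine_hull K : set {ffun T -> R} :=
  [set y : {ffun T -> R} | exists s : seq (R * {ffun T -> R}),
     [/\ forall e, e \in s -> K e.2,
         \sum_(e <- s) e.1 = 1
       & forall t, y t = \sum_(e <- s) e.1 * e.2 t]].

Definition relint K : set {ffun T -> R} :=
  [set x | K x /\ exists2 eps : R, 0 < eps &
     forall y, affine_hull K y -> (forall t, `|y t - x t| < eps) -> K y].

End Cones.

Section GroebnerFan.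
Variables (R : realType) (n : nat).

(* [val A] = {0, ..., k - 1} encodes the tuple (1, ..., k). *)
Definition Xi0 : set (Xi R n) :=
  [set S : Xi R n | forall A : pindex n,
     val A = [set i : 'I_n | (i < #|val A|)%N]%SET -> S A = 0].

Definition groebner_class (S : Xi R n) : set (Xi R n) :=
  [set S' | Xi0 S' /\ init_ideal S' = init_ideal S].

Definition groebner_cone (K : set (Xi R n)) : Prop :=
  [/\ K `<=` Xi0, rational_cone K
    & exists2 S, Xi0 S & relint K = groebner_class S].

Definition trop_cone (K : set (Xi R n)) : Prop :=
  groebner_cone K /\ forall S, relint K S -> monomial_free (init_ideal S).

Definition maximal_trop_cone (K : set (Xi R n)) : Prop :=
  trop_cone K /\ forall K', trop_cone K' -> K `<=` K' -> K' = K.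

End GroebnerFan.

Section Sigma.
Variables (R : realType) (n : nat).

Definition Tvec (A : pindex n) : Theta R n :=
  [ffun p : pos n =>
     ([exists l : 'I_#|val A|,
         ((l : nat) == (val p).1) && (enum_val l == (val p).2)])%:R].

Definition sigma (a : Theta R n) : Xi R n :=
  [ffun A : pindex n => \sum_(p : pos n) a p * Tvec A p].

(* The entry of a at (i, j); the value 0 outside i < j < n is a placeholder.  *)
Definition entry (a : Theta R n) (i j : nat) : R :=
  \sum_(p : pos n | ((val p).1 == i :> nat) && ((val p).2 == j :> nat)) a p.

Definition coneK : set (Theta R n) :=
  [set a |
     (forall i : nat, (i.+2 < n)%N ->
        entry a i i.+1 + entry a i.+1 i.+2 <= entry a i i.+2) /\
     (forall i j : nat, (i.+1 < j)%N -> (j.+1 < n)%N ->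
        entry a i j + entry a i.+1 j.+1 <= entry a i j.+1 + entry a i.+1 j)].

End Sigma.

(* Main.v *)
Require Import Defs.
From mathcomp Require Import all_boot all_order all_algebra all_fingroup.
From mathcomp Require Import complex.
From mathcomp Require Import classical_sets reals.
From mathcomp Require Import mpoly.
From mathcomp Require Import zify ring lra.

(** The coordinates of F are the minors of a matrix on its first columns.
    Restrict them to generic lower unitriangular matrices, whose entry in row j
    and column l < j is an independent variable z_(l,j), and give z_(l,j) the
    weight a_(l,j). When a lies in the interior of K, the defining inequalities
    add up to the strict Monge inequalities, so the diagonal term of every minor
    is its only term of lowest weight ([diagonal_min], [leads_zpcoord]). This
    term is the monomial with exponent T, and its weight is the coordinate of
    sigma(a). Passing to lowest terms, the initial part of an element of I
    satisfies the linear relations between the monomials z^T: it belongs to the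
    toric ideal J of the polynomials whose coefficients have sum 0 over the
    monomials of any given multidegree and T-degree ([init_part_toric]).

    For the converse, call a monomial standard when its variables form the
    columns of a semistandard tableau. Standard monomials span R modulo I
    ([straightening]), and a standard monomial is determined by its multidegree
    and its T-degree ([standard_key_inj]), so that J contains no nonzero
    combination of them. If m is not standard and X^m - h is in I, with h a
    combination of standard monomials, the initial part of X^m - h lies in J,
    hence involves X^m, and hence is X^m - X^s for the standard s with the degrees of m ([init_straightening]).
    These binomials span J, so the initial ideal at sigma(a) is J for every a
    in the interior of K ([init_ideal_sigma]). No monomial lies in J.

    Suppose now that the initial ideal at S is J. As J contains no monomial, it
    can only be homogeneous for grad^S if S is constant on each set of monomials
    with given degrees ([toric_grad_const]). The product of the variables of the
    sets {1, ..., l - 1, i_l} has the degrees of X_(i_1, ..., i_k) times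
    variables on which S vanishes, so S = sigma(a) ([grad_const_sigma]). The
    three-term relations then force a to be in the interior of K
    ([strictK_of_init_ideal]). So the class of sigma(a) is the image of the
    interior of K, which is the relative interior of sigma(K)
    ([relint_sigma_cone]).

    For maximality, let K' be a tropical cone containing sigma(K) and let S' be
    in its relative interior; then so is sigma(a) + e S' for e > 0. If S' told
    apart the two terms of some X^m - X^s above, then for small e the initial
    part of its lift to I would be a monomial ([perturbed_grad_const]). Hence S'
    is in the image of sigma, sigma(a) + e S' is in the relative interior of
    sigma(K) for small e, and the two cones belong to the same class. *)

Set Implicit Arguments.
Unset Strict Implicit.
Unset Printing Implicit Defensive.

Import Order.TTheory GRing.Theory Num.Theory.

Local Open Scope ring_scope.
Local Open Scope classical_set_scope.
Local Open Scope complex_scope.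

(** * Subsets of {0, ..., n - 1} as tableau columns *)

Section Entries.
Variable n : nat.
Implicit Types (A B : {set 'I_n}) (l : nat).

(** The default value n, above all entries, makes a column that is too short
    behave like one continued by infinitely large entries. *)
Definition elt A l : nat := nth n [seq val i | i <- enum A] l.

Lemma size_elts A : size [seq val i | i <- enum A] = #|A|.
Proof. by rewrite size_map -cardE. Qed.

Lemma sorted_elts A : sorted ltn [seq val i | i <- enum A].
Proof.
apply: (subseq_sorted ltn_trans (s2 := iota 0 n)); last exact: iota_ltn_sorted.
by rewrite -val_enum_ord; apply: map_subseq; rewrite enumT [X in subseq X]/enum_mem filter_subseq.
Qed.

Lemma elt_enum_val A (r : 'I_#|A|) : (enum_val r : nat) = elt A r.
Proof.
rewrite /elt (nth_map (enum_val r)); last by rewrite -cardE.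
by rewrite -(enum_val_nth (enum_val r)).
Qed.

Lemma elt_lt A l : (l < #|A|)%N -> (elt A l < n)%N.
Proof. by move=> lA; rewrite -(elt_enum_val (Ordinal lA)) ltn_ord. Qed.

Lemma elt_default A l : (#|A| <= l)%N -> elt A l = n.
Proof. by move=> lA; rewrite /elt nth_default // size_elts. Qed.

Lemma elt_le A l : (elt A l <= n)%N.
Proof. by case: (ltnP l #|A|) => [/elt_lt/ltnW|/elt_default->]. Qed.

Lemma elt_ltn_card A l : (elt A l < n)%N = (l < #|A|)%N.
Proof. by case: (ltnP l #|A|) => [/elt_lt//|/elt_default->]; rewrite ltnn. Qed.

Lemma elt_mono A l l' : (l < l' < #|A|)%N -> (elt A l < elt A l')%N.
Proof.
case/andP=> ll' l'A; have lA := ltn_trans ll' l'A.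
by apply: (sorted_ltn_nth ltn_trans n (sorted_elts A)); rewrite ?inE ?size_elts.
Qed.

Lemma elt_id_le A l : (l <= n)%N -> (l <= elt A l)%N.
Proof.
case: (ltnP l #|A|) => [lA _|/elt_default-> //].
elim: l lA => // l IH lA; have := IH (ltnW lA).
by move/leq_ltn_trans; apply; apply: elt_mono; rewrite ltnSn.
Qed.

Lemma mem_eltP A (i : 'I_n) :
  reflect (exists2 l, (l < #|A|)%N & elt A l = i) (i \in A).
Proof.
apply: (iffP idP) => [iA|[l lA e]].
  exists (enum_rank_in iA i) => //.
  by rewrite -elt_enum_val enum_rankK_in.
have -> : i = enum_val (Ordinal lA) by apply: val_inj; rewrite /= elt_enum_val -e.
exact: enum_valP.
Qed.

Lemma elt_inj A B : (forall l, (l < n)%N -> elt A l = elt B l) -> A = B.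
Proof.
have sub (C D : {set 'I_n}) : (forall l, (l < n)%N -> elt C l = elt D l) ->
    C \subset D.
  move=> eCD; apply/fintype.subsetP=> i /mem_eltP[l lC e]; apply/mem_eltP; exists l.
    by rewrite -elt_ltn_card -eCD ?e ?(leq_trans lC) ?card_set_ord_le.
  by rewrite -eCD // (leq_trans lC) ?card_set_ord_le.
by move=> eAB; apply/eqP; rewrite finset.eqEsubset !sub // => l /eAB.
Qed.

(** Whether A may stand to the left of B in a semistandard tableau. Thanks to
    the default value of [elt], this includes #|B| <= #|A|. *)
Definition ple A B := [forall l : 'I_n, elt A l <= elt B l]%N.

Lemma pleP A B : reflect (forall l, (l < n)%N -> (elt A l <= elt B l)%N) (ple A B).
Proof.
apply: (iffP forallP) => [h l ln|h l]; last exact: h.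
exact: (h (Ordinal ln)).
Qed.

Lemma ple_refl : reflexive ple.
Proof. by move=> A; apply/pleP. Qed.

Lemma ple_trans : transitive ple.
Proof.
move=> A B C /pleP BA /pleP AC; apply/pleP=> l ln.
exact: leq_trans (BA l ln) (AC l ln).
Qed.

Lemma ple_anti A B : ple A B -> ple B A -> A = B.
Proof.
move=> /pleP AB /pleP BA; apply: elt_inj => l ln.
by apply/eqP; rewrite eqn_leq AB // BA.
Qed.

End Entries.

(** * Standard monomials are determined by their degrees *)

Definition pindex_of (n : nat) (A : {set 'I_n}) (hA : (0 < #|A| < n)%N) : pindex n :=
  exist (fun A : {set 'I_n} => is_true (0 < #|A| < n)%N) A hA.

Section StandardMonomials.
Variable n : nat.
Implicit Types (A B D : pindex n) (m : pmonom n).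

Definition mult m A : nat := m (enum_rank A).

Lemma multD m m' A : mult (m + m')%MM A = (mult m A + mult m' A)%N.
Proof. by rewrite /mult mnmDE. Qed.

Lemma mult1 A B : mult U_(enum_rank A)%MM B = (A == B).
Proof. by rewrite /mult mnm1E (inj_eq enum_rank_inj). Qed.

Lemma sum_mult1 A (F : pindex n -> nat) :
  (\sum_(B : pindex n) mult U_(enum_rank A)%MM B * F B = F A)%N.
Proof.
rewrite (bigD1 A) //= mult1 eqxx mul1n big1 ?addn0 // => B BA.
by rewrite mult1 eq_sym (negPf BA).
Qed.

Lemma mult_inj m m' : (forall A, mult m A = mult m' A) -> m = m'.
Proof.
by move=> e; apply/mnmP => i; have := e (enum_val i); rewrite /mult enum_valK.
Qed.

Definition standard m := forall A B,
  (0 < mult m A)%N -> (0 < mult m B)%N -> ple (val A) (val B) || ple (val B) (val A).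

(** The exponent of the image of X^m under X_A |-> z^T(A). *)
Definition Tdeg m : 'X_{1..#|{: pos n}|} :=
  [multinom (\sum_(A : pindex n)
     mult m A * (elt (val A) (val (enum_val p)).1 == (val (enum_val p)).2))%N
   | p < #|{: pos n}|].

Lemma Tdeg1 A p : Tdeg U_(enum_rank A)%MM p =
  (elt (val A) (val (enum_val p)).1 == (val (enum_val p)).2).
Proof. by rewrite mnmE sum_mult1. Qed.

Definition eltcount m (l j : nat) : nat :=
  (\sum_(A : pindex n) mult m A * (elt (val A) l == j))%N.

Lemma eltcountD m m' l j :
  eltcount (m + m')%MM l j = (eltcount m l j + eltcount m' l j)%N.
Proof.
by rewrite /eltcount -big_split; apply: eq_bigr => A _; rewrite multD mulnDl.
Qed.

Lemma eltcount_gt0 m l j : (0 < eltcount m l j)%N ->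
  exists2 A, (0 < mult m A)%N & elt (val A) l = j.
Proof.
rewrite lt0n sum_nat_eq0 => /forallPn[A]; rewrite /= muln_eq0 negb_or -lt0n.
by rewrite eqb0 negbK => /andP[? /eqP]; exists A.
Qed.

Lemma eltcount_elt_gt0 m A l : (0 < mult m A)%N -> (0 < eltcount m l (elt (val A) l))%N.
Proof. by move=> mA; rewrite /eltcount (bigD1 A) //= eqxx muln1 addn_gt0 mA. Qed.

(** Each row l of the tableau of m, padded with the default value, has as many
    entries as m has variables. *)
Lemma sum_eltcount m l :
  (\sum_(j < n.+1) eltcount m l j = \sum_(k < n) multideg m k)%N.
Proof.
transitivity (\sum_(A : pindex n) mult m A)%N.
  rewrite exchange_big /=; apply: eq_bigr => A _.
  rewrite (bigD1 (Ordinal (elt_le (val A) l : (elt (val A) l < n.+1)%N))) //= eqxx.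
  rewrite muln1 big1 ?addn0 // => j; rewrite -val_eqE /= => /negPf.
  by rewrite eq_sym => ->; rewrite muln0.
under [RHS]eq_bigr => k _ do rewrite ffunE big_mkcond.
rewrite exchange_big /=; apply: eq_bigr => A _.
have /andP[_ An] := valP A.
rewrite (bigD1 (Ordinal An)) //= eqxx big1 ?addn0 // => k.
by rewrite -val_eqE /= eq_sym => /negPf->.
Qed.

(** The T-degree counts the entries j > l of row l, and the multidegree counts
    the columns that end above row l, that is, the entries n. The remaining
    entries of row l are all equal to l, and [sum_eltcount] gives their number. *)
Lemma eltcount_key m m' : multideg m = multideg m' -> Tdeg m = Tdeg m' ->
  forall l j, (l < n)%N -> eltcount m l j = eltcount m' l j.
Proof.
move=> ed et l j ln.
have above k : (l < k)%N -> eltcount m l k = eltcount m' l k.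
  case: (ltngtP k n) => [kn lk|nk _|-> _].
  - pose p : pos n := Sub (Ordinal ln, Ordinal kn) lk.
    have := congr1 (fun t : 'X_{1.._} => t (enum_rank p)) et.
    by rewrite /Tdeg !mnmE enum_rankK.
  - rewrite /eltcount !big1 // => A _;
    by rewrite ltn_eqF ?muln0 // (leq_ltn_trans (elt_le _ _)).
  - suff e (x : pmonom n) : eltcount x l n =
        (\sum_(k < n | (k <= l)%N) multideg x k)%N by rewrite !e ed.
    under [RHS]eq_bigr => i _ do rewrite ffunE big_mkcond.
    rewrite exchange_big /=; apply: eq_bigr => A _; have /andP[_ An] := valP A.
    rewrite -big_mkcondr /=.
    case: (ltnP l #|val A|) => lA.
      rewrite big_pred0 ?(ltn_eqF (elt_lt lA)) ?muln0 // => i.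
      by apply/negP=> /andP[+ /eqP e]; rewrite -e leqNgt lA.
    rewrite (big_pred1 (Ordinal An)) ?(elt_default lA) ?eqxx ?muln1 // => i.
    rewrite /= -[RHS]val_eqE /= [RHS]eq_sym; case: eqP => // e; last by rewrite andbF.
    by rewrite -e lA.
case: (ltngtP l j) => [|jl|<-]; first exact: above.
  rewrite /eltcount !big1 // => A _;
  by rewrite gtn_eqF ?muln0 // (leq_trans jl) ?elt_id_le // ltnW.
have := sum_eltcount m l; rewrite ed -(sum_eltcount m' l).
rewrite (bigD1 (Ordinal (ltnW ln : (l < n.+1)%N))) //=.
rewrite [in RHS](bigD1 (Ordinal (ltnW ln : (l < n.+1)%N))) //=.
set s := bigop _ _ _; set s' := bigop _ _ _ => e.
suff ss : s = s' by move: e; rewrite ss => /addIn.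
apply: eq_bigr => k; rewrite -val_eqE /= => kl.
case: (ltngtP l k) kl => [lk _|kl _|//]; first exact: above.
rewrite /eltcount !big1 // => A _;
by rewrite gtn_eqF ?muln0 // (leq_trans kl) ?elt_id_le // ltnW.
Qed.

(** A variable with the fewest variables below it is below all others, since
    the support is a chain. *)
Lemma standard_min m : standard m -> m != 0%MM ->
  exists2 A, (0 < mult m A)%N & forall B, (0 < mult m B)%N -> ple (val A) (val B).
Proof.
move=> sm m0.
have [A0 mA0] : exists A, (0 < mult m A)%N.
  apply/existsP; apply: contraNT m0; rewrite negb_exists => /forallP h.
  by apply/eqP/mult_inj => A; rewrite /mult mnm0E; have := h A; rewrite lt0n negbK => /eqP.
pose below (A : pindex n) := [set D : pindex n | (0 < mult m D)%N && ple (val D) (val A)]%SET.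
have [A mA minA] := @arg_minnP _ A0 (fun A => 0 < mult m A)%N (fun A => #|below A|) mA0; exists A => // B mB.
have /orP[//|BA] := sm A B mA mB.
have sub : below B \subset below A.
  by apply/fintype.subsetP=> D; rewrite !inE => /andP[-> DB] /=; exact: ple_trans BA.
have eAB : below B = below A by apply/eqP; rewrite finset.eqEcard sub minA.
have : A \in below B by rewrite eAB inE mA ple_refl.
by rewrite inE => /andP[].
Qed.

(** The leftmost column of a standard tableau consists of the smallest entries
    of its rows, so the row contents determine it; remove it and iterate. *)
Lemma standard_key_inj m m' : standard m -> standard m' ->
  multideg m = multideg m' -> Tdeg m = Tdeg m' -> m = m'.
Proof.
move=> sm sm' ed et; have {ed et} := eltcount_key ed et.
have [d] := ubnP (mdeg m); elim: d => // d IH in m m' sm sm' *.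
move=> dm cnt.
have nz (x y : pmonom n) : (forall l j, (l < n)%N -> eltcount x l j = eltcount y l j) ->
    standard x -> x != 0%MM -> y != 0%MM.
  move=> exy sx /(standard_min sx)[A xA _]; have /andP[A0 An] := valP A.
  have n0 : (0 < n)%N by apply: leq_ltn_trans An.
  have := eltcount_elt_gt0 0 xA; rewrite exy // => /eltcount_gt0[B yB _].
  by apply: contraTneq yB => ->; rewrite /mult mnm0E.
have [m0|m0] := eqVneq m 0%MM.
  apply/esym/eqP; rewrite m0; apply: contraT => m'0.
  have cnt' l j : (l < n)%N -> eltcount m' l j = eltcount m l j by move=> /cnt->.
  by have := nz _ _ cnt' sm' m'0; rewrite m0 eqxx.
have m'0 := nz _ _ cnt sm m0.
have [A mA minA] := standard_min sm m0; have [B mB minB] := standard_min sm' m'0.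
have eAB : A = B.
  apply/val_inj/ple_anti; apply/pleP=> l ln.
    have := eltcount_elt_gt0 l mB; rewrite -cnt // => /eltcount_gt0[D mD <-].
    by move/minA/pleP: mD; apply.
  have := eltcount_elt_gt0 l mA; rewrite cnt // => /eltcount_gt0[D mD <-].
  by move/minB/pleP: mD; apply.
rewrite -{B minB}eAB in mB.
have split (x : pmonom n) : (0 < mult x A)%N -> x = (U_(enum_rank A) + (x - U_(enum_rank A)))%MM.
  by move=> xA; rewrite addmC submK // lep1mP -lt0n.
rewrite (split m mA) (split m' mB) in cnt sm sm' dm *.
move: {split mA mB m0 m'0 nz minA} (m - _)%MM (m' - _)%MM cnt sm sm' dm => x y cnt sx sy dx.
have sub (z : pmonom n) : standard (U_(enum_rank A) + z)%MM -> standard z.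
  by move=> sz B D zB zD; apply: sz; rewrite multD ltn_addl.
congr (_ + _)%MM; apply: IH; [exact: sub|exact: sub| |].
  by move: dx; rewrite mdegD mdeg1 add1n ltnS.
by move=> l j /(cnt l j); rewrite !eltcountD => /addnI.
Qed.

End StandardMonomials.

(** * Coefficients and values of polynomials *)

Section CoefSum.
Variables (K : comNzRingType) (N : nat).
Implicit Types (F : 'X_{1..N} -> K) (p q : {mpoly K[N]}).

Definition coefsum F p : K := \sum_(m <- msupp p) p@_m * F m.

Lemma coefsum_supp (s : seq 'X_{1..N}) F p : uniq s -> {subset msupp p <= s} ->
  coefsum F p = \sum_(m <- s) p@_m * F m.
Proof.
move=> us sub; rewrite [RHS](bigID (mem (msupp p))) /= [X in _ + X]big1 ?addr0.
  rewrite -big_filter; apply: perm_big; apply: uniq_perm.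
  - exact: msupp_uniq.
  - exact: filter_uniq.
  by move=> m; rewrite mem_filter; case: (boolP (m \in msupp p)) => // /sub->.
by move=> m /memN_msupp_eq0->; rewrite mul0r.
Qed.

Lemma coefsum_lin F a p q : coefsum F (a *: p + q) = a * coefsum F p + coefsum F q.
Proof.
pose s := undup (msupp p ++ msupp q).
have ps : {subset msupp p <= s} by move=> m mp; rewrite mem_undup mem_cat mp.
have qs : {subset msupp q <= s} by move=> m mq; rewrite mem_undup mem_cat mq orbT.
have pqs : {subset msupp (a *: p + q) <= s}.
  move=> m /msuppD_le; rewrite mem_undup !mem_cat => /orP[/msuppZ_le->//|->].
  by rewrite orbT.
rewrite !(@coefsum_supp s) ?undup_uniq // mulr_sumr -big_split.
by apply: eq_bigr => m _; rewrite mcoeffD mcoeffZ mulrDl mulrA.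
Qed.

Lemma coefsum0 F : coefsum F 0 = 0.
Proof. by rewrite /coefsum msupp0 big_nil. Qed.

Lemma coefsumZ F a p : coefsum F (a *: p) = a * coefsum F p.
Proof. by rewrite -[a *: p]addr0 coefsum_lin coefsum0 addr0. Qed.

Lemma coefsumD F p q : coefsum F (p + q) = coefsum F p + coefsum F q.
Proof. by rewrite -[p]scale1r coefsum_lin mul1r scale1r. Qed.

Lemma coefsumB F p q : coefsum F (p - q) = coefsum F p - coefsum F q.
Proof. by rewrite -scaleN1r coefsumD coefsumZ mulN1r. Qed.

Lemma coefsum_sum (I : Type) (r : seq I) (P : pred I) F (G : I -> {mpoly K[N]}) :
  coefsum F (\sum_(i <- r | P i) G i) = \sum_(i <- r | P i) coefsum F (G i).
Proof. by apply: (big_morph _ (coefsumD F) (coefsum0 F)). Qed.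

Lemma coefsumX F m : coefsum F 'X_[m] = F m.
Proof. by rewrite /coefsum msuppX big_seq1 mcoeffX eqxx mul1r. Qed.

End CoefSum.

Lemma mem_msupp_sum (K : nzRingType) (N : nat) (I : finType) (P : pred I)
    (G : I -> {mpoly K[N]}) m :
  m \in msupp (\sum_(i | P i) G i) -> exists2 i, P i & m \in msupp (G i).
Proof.
rewrite mcoeff_msupp raddf_sum /= => m0.
suff /existsP[i /andP[]] : [exists i, P i && (m \in msupp (G i))] by exists i.
apply: contraNT m0; rewrite negb_exists => /forallP h.
rewrite big1 // => i Pi; apply: memN_msupp_eq0.
by have := h i; rewrite Pi.
Qed.

Lemma mcoeff_restrict (K : nzRingType) (N : nat) (P : pred 'X_{1..N}) (p : {mpoly K[N]}) m :
  (\sum_(m' <- msupp p | P m') p@_m' *: 'X_[m'])@_m = if P m then p@_m else 0.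
Proof.
rewrite raddf_sum /= big_mkcond /=.
have [mp|/memN_msupp_eq0 p0] := boolP (m \in msupp p); last first.
  rewrite p0 if_same big_seq big1 // => m' m'p; case: ifP => // _.
  rewrite mcoeffZ mcoeffX; case: eqP => [e|_]; last by rewrite mulr0.
  by move: m'p; rewrite mcoeff_msupp e p0 eqxx.
rewrite (bigD1_seq m) ?msupp_uniq //= big1 ?addr0 => [|m' m'm].
  by case: ifP => // _; rewrite mcoeffZ mcoeffX eqxx mulr1.
by case: ifP => // _; rewrite mcoeffZ mcoeffX (negPf m'm) mulr0.
Qed.

Lemma digits_inj (D N : nat) (f g : 'I_N -> nat) :
  (forall i, f i < D)%N -> (forall i, g i < D)%N ->
  (\sum_i f i * D ^ i = \sum_i g i * D ^ i)%N -> f =1 g.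
Proof.
elim: N f g => [f g _ _ _ []//|N IH f g fD gD].
rewrite !big_ord_recl /= !expn0 !muln1.
have shift (h : 'I_N.+1 -> nat) : (\sum_(i < N) h (lift ord0 i) * D ^ bump 0 i =
    (\sum_(i < N) h (lift ord0 i) * D ^ i) * D)%N.
  by rewrite big_distrl; apply: eq_bigr => i _; rewrite /bump /= add1n expnSr mulnA.
rewrite !shift => e.
have D0 : (0 < D)%N by apply: leq_ltn_trans (fD ord0).
have e0 : f ord0 = g ord0.
  have := congr1 (modn^~ D) e.
  by rewrite /= ![(_ ord0 + _)%N]addnC !modnMDl !modn_small.
move: e; rewrite e0 => /addnI/eqP; rewrite eqn_pmul2r // => /eqP/IH e i.
case: (unliftP ord0 i) => [j ->|-> //]; exact: (e (fun j => fD _) (fun j => gD _)).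
Qed.

(** Kronecker substitution: with D above all exponents, x_i := t ^ (D ^ i) maps
    distinct monomials to distinct powers of t, and the resulting polynomial in
    t vanishes at all natural numbers. *)
Lemma mpoly_eq0 (K : numDomainType) (N : nat) (p : {mpoly K[N]}) :
  (forall v, p.@[v] = 0) -> p = 0.
Proof.
move=> p0; set D := msize p.
pose e (m : 'X_{1..N}) := (\sum_i m i * D ^ i)%N.
have e_inj : {in msupp p &, injective e}.
  move=> m m' mp m'p /digits_inj h; apply/mnmP/h => i.
    by apply: leq_ltn_trans (msize_mdeg_lt mp); rewrite mdegE (bigD1 i) //= leq_addr.
  by apply: leq_ltn_trans (msize_mdeg_lt m'p); rewrite mdegE (bigD1 i) //= leq_addr.
pose q : {poly K} := \sum_(m <- msupp p) p@_m *: 'X^(e m).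
have q0 : q = 0.
  (* More roots than the degree allows. *)
  pose s : seq K := [seq k%:R | k <- iota 0 (size q)].
  apply/eqP; apply: contraT => qN0; have := @max_poly_roots _ q s qN0.
  rewrite size_map size_iota ltnn => -> //; last first.
    by rewrite map_inj_uniq ?iota_uniq // => i j /eqP; rewrite eqr_nat => /eqP.
  apply/allP => _ /mapP[k _ ->]; rewrite /root /q horner_sum.
  rewrite -[X in _ == X](p0 (fun i => k%:R ^+ (D ^ i))) mevalE; apply/eqP.
  apply: eq_bigr => m _; rewrite hornerZ hornerXn; congr (_ * _).
  by rewrite /e -prodrXr; apply: eq_bigr => i _; rewrite -exprM mulnC.
apply/eqP; rewrite -msupp_eq0; apply: contraT; case E: (msupp p) => [//|m r] _.
have mp : m \in msupp p by rewrite E mem_head.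
have : q`_(e m) = 0 by rewrite q0 coef0.
rewrite /q coef_sum (bigD1_seq m) ?msupp_uniq //= coefZ coefXn eqxx mulr1.
rewrite big_seq_cond big1 ?addr0 => [pm|m' /andP[m'p m'm]].
  by move: mp; rewrite mcoeff_msupp pm eqxx.
rewrite coefZ coefXn; case: eqP => [/e_inj em|_]; last by rewrite mulr0.
by rewrite em ?eqxx in m'm.
Qed.

(** * The ideal of the flag variety *)

Section PluckerIdealTheory.
Variables (R : realType) (n : nat).
Implicit Types (f h : pring R n) (g : 'M[R[i]]_n) (d : {ffun 'I_n -> nat}).

Lemma meval_multihomog d f v :
  (multihomog_part d f).@[v] =
    coefsum (fun m => (multideg m == d)%:R * ('X_[m] : pring R n).@[v]) f.
Proof.
rewrite /multihomog_part raddf_sum big_mkcond; apply: eq_bigr => m _.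
by rewrite /= mevalZ; case: eqP; rewrite ?mul1r ?mul0r ?mulr0.
Qed.

Lemma pideal_lin c f h : pideal f -> pideal h -> pideal (c *: f + h).
Proof.
move=> If Ih d g g1; rewrite meval_multihomog coefsum_lin -!meval_multihomog.
by rewrite If // Ih // mulr0 addr0.
Qed.

Lemma pideal0 : pideal (0 : pring R n).
Proof. by move=> d g _; rewrite meval_multihomog coefsum0. Qed.

Lemma pidealZ c f : pideal f -> pideal (c *: f).
Proof. by move=> If; rewrite -[_ *: _]addr0; apply: pideal_lin => //; apply: pideal0. Qed.

Lemma pidealD f h : pideal f -> pideal h -> pideal (f + h).
Proof. by move=> If Ih; rewrite -[f]scale1r; exact: pideal_lin. Qed.

Lemma pideal_sum (I : Type) (r : seq I) (P : pred I) (G : I -> pring R n) :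
  (forall i, P i -> pideal (G i)) -> pideal (\sum_(i <- r | P i) G i).
Proof. by move=> IG; apply: big_ind => //; [exact: pideal0 | exact: pidealD]. Qed.

Lemma pideal_multihomog d f : {in msupp f, forall m, multideg m = d} ->
  (forall g, f.@[ppoint g] = 0) -> pideal f.
Proof.
move=> fd f0 d' g _; rewrite meval_multihomog /coefsum big_seq.
have [->|dd'] := eqVneq d' d; last first.
  by rewrite big1 // => m /fd->; rewrite eq_sym (negPf dd') mul0r mulr0.
rewrite -[RHS](f0 g) mevalE [RHS]big_seq; apply: eq_bigr => m /fd->.
by rewrite eqxx mul1r mevalX.
Qed.

Lemma meval_var g (A : pindex n) :
  ('X_(enum_rank A) : pring R n).@[ppoint g] = pcoord g A.
Proof. by rewrite mevalXU /ppoint enum_rankK. Qed.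

End PluckerIdealTheory.

(** * Minors on tuples of rows *)

Section TupleMinors.
Variables (R : realType) (n : nat).
Implicit Types (g : 'M[R[i]]_n) (A B : pindex n).

(** The rows may repeat or come in any order, which turns the minors into an
    alternating function of the rows. *)
Definition tminor k (kn : (k <= n)%N) g (t : 'I_k -> 'I_n) : R[i] :=
  \det (\matrix_(r < k, c < k) g (t r) (widen_ord kn c)).

Lemma tminor_noninj k (kn : (k <= n)%N) g (t : 'I_k -> 'I_n) :
  ~~ injectiveb t -> tminor kn g t = 0.
Proof.
case/injectivePn=> x [y xy txy]; apply: (determinant_alternate xy) => c.
by rewrite !mxE txy.
Qed.

Lemma tminor_perm k (kn : (k <= n)%N) g (t : 'I_k -> 'I_n) (s : 'S_k) :
  tminor kn g (t \o s) = (-1) ^+ s * tminor kn g t.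
Proof.
rewrite -det_perm -det_mulmx -row_permE; congr (\det _).
by apply/matrixP=> r c; rewrite !mxE.
Qed.

Lemma eq_tminor k (kn : (k <= n)%N) g (t t' : 'I_k -> 'I_n) :
  t =1 t' -> tminor kn g t = tminor kn g t'.
Proof.
by move=> tt'; congr (\det _); apply/matrixP=> r c; rewrite !mxE tt'.
Qed.

Lemma tminor_mono k (kn : (k <= n)%N) g (t : 'I_k -> 'I_n) A :
  #|val A| = k -> (forall r : 'I_k, elt (val A) r = t r) -> tminor kn g t = pcoord g A.
Proof.
move=> Ak; case: _ / Ak in kn t *; move=> tA; congr (\det _).
apply/matrixP=> r c; rewrite !mxE; congr (g _ _); apply: val_inj => //=.
by rewrite -tA elt_enum_val.
Qed.

Lemma tminor_inj k (kn : (k <= n)%N) (t : 'I_k -> 'I_n) A :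
  injective t -> #|val A| = k -> (forall r, t r \in val A) ->
  exists c : R[i], forall g, tminor kn g t = c * pcoord g A.
Proof.
move=> tinj Ak; case: _ / Ak in kn t tinj *; move=> tA.
have /andP[A0 _] := valP A.
have xA : enum_val (Ordinal A0) \in val A by apply: enum_valP.
pose f r := enum_rank_in xA (t r).
have finj : injective f.
  by move=> r r' /(congr1 enum_val); rewrite /f !enum_rankK_in // => /tinj.
exists ((-1) ^+ perm finj) => g.
rewrite -(@tminor_mono _ kn g (fun r => enum_val r) A) // => [|r]; last first.
  by rewrite elt_enum_val.
rewrite -tminor_perm; apply: eq_tminor => r /=.
by rewrite permE /f enum_rankK_in.
Qed.

End TupleMinors.

(** * Garnir relations *)

Section Garnir.
Variables (R : realType) (n k m l : nat).
Hypotheses (kn : (k <= n)%N) (mk : (m <= k)%N) (lm : (l < m)%N).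
Let mn : (m <= n)%N := leq_trans mk kn.
Variable (v : 'I_k + 'I_m -> 'I_n).
Implicit Types (g : 'M[R[i]]_n) (s : {perm 'I_k + 'I_m}).

(** The positions of the two columns are the elements of 'I_k + 'I_m. Those from
    l downwards on the left and those up to l on the right are exchanged; there
    are k + 1 of them, one more than the minors have columns. *)
Definition exchange_set : {set 'I_k + 'I_m} :=
  [set x : 'I_k + 'I_m | match x with inl i => l <= i | inr j => j <= l end]%N%SET.

Definition left_positions : {set 'I_k + 'I_m} := [set x : 'I_k + 'I_m | if x is inl _ then true else false]%SET.

Definition garnir_term g s : R[i] := (-1) ^+ s *
  (tminor kn g (fun i => v (s (inl i))) * tminor mn g (fun j => v (s (inr j)))).

Lemma card_exchange_set : #|exchange_set| = k.+1.
Proof.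
have widen_ord_inj a b (ab : (a <= b)%N) : injective (widen_ord ab).
  by move=> i j /(congr1 val) /= /val_inj.
rewrite -sum1_card big_mkcond big_sumType /=.
under eq_bigr do rewrite inE; under [X in (_ + X)%N]eq_bigr do rewrite inE.
rewrite -!big_mkcond !sum1_card.
have -> : #|(fun j : 'I_m => (j <= l)%N)| = l.+1.
  rewrite -[RHS]card_ord -(card_image (widen_ord_inj _ _ lm) predT) /=.
  apply: eq_card => j; rewrite [LHS]unfold_in; apply/idP/fintype.imageP => [jl|[i _ ->]]; last first.
    by rewrite /= -ltnS.
  by exists (Ordinal (jl : (j < l.+1)%N)) => //; apply: val_inj.
have lk : (l <= k)%N by apply: leq_trans mk; apply: ltnW.
have := cardC (fun i : 'I_k => (l <= i)%N); rewrite card_ord.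
have -> : #|[predC (fun i : 'I_k => (l <= i)%N)]| = l.
  rewrite -[RHS]card_ord -(card_image (widen_ord_inj _ _ lk) predT) /=.
  apply: eq_card => j; rewrite !inE [X in ~~ X]unfold_in -ltnNge; apply/idP/fintype.imageP => [jl|[i _ ->]]; last exact: (ltn_ord i).
  by exists (Ordinal jl) => //; apply: val_inj.
by move=> e; rewrite addnS -[in RHS]e.
Qed.

(** The involution s |-> tperm x y * s changes the sign of each term. *)
Lemma alternating_sum0 (g : 'M[R[i]]_n) (T : finType) (w : T -> 'I_n) (C : {set T})
  (col : T -> 'I_n) (x y : T) : x \in C -> y \in C -> x != y -> col x = col y ->
  \sum_(s : {perm T} | perm_on C s) (-1) ^+ s * \prod_z g (w (s z)) (col z) = 0.
Proof.
move=> xC yC xy cxy; set S := bigop _ _ _.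
suff : S = - S.
  by move/eqP; rewrite -subr_eq0 opprK -mulr2n mulrn_eq0 => /eqP.
have tC : perm_on C (tperm x y).
  apply/fintype.subsetP=> z; rewrite unfold_in.
  by case: tpermP => [->|->|]; rewrite ?eqxx.
rewrite {1}/S (reindex_inj (mulgI (tperm x y))) /= -sumrN.
have onE (s : {perm T}) : perm_on C (tperm x y * s)%g = perm_on C s.
  apply/idP/idP => h; last exact: perm_onM.
  by rewrite -[s]mul1g -(tperm2 x y) -mulgA perm_onM.
apply: eq_big => // s _.
rewrite odd_permM odd_tperm xy signr_addb expr1 !mulN1r -mulNr; congr (_ * _).
rewrite (reindex_inj (@perm_inj _ (tperm x y))) /=.
apply: eq_bigr => z _; rewrite permM tpermK; congr (g _ _).
by case: tpermP => [->|->|//].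
Qed.

(** Antisymmetrizing over k + 1 rows with only k columns available gives 0: in
    each term of the Leibniz expansions, two exchanged positions use the same
    column. *)
Lemma garnir_sum0 g : \sum_(s | perm_on exchange_set s) garnir_term g s = 0.
Proof.
rewrite /garnir_term /tminor /determinant.
under eq_bigr => s _ do rewrite big_distrlr /= mulr_sumr.
rewrite exchange_big big1 // => p1 _ /=.
under eq_bigr => s _ do rewrite mulr_sumr.
rewrite exchange_big big1 // => p2 _ /=.
pose colk (x : 'I_k + 'I_m) : 'I_k :=
  match x with inl i => p1 i | inr j => widen_ord mk (p2 j) end.
have [x [y [xC yC xy cxy]]] : exists x y,
    [/\ x \in exchange_set, y \in exchange_set, x != y & colk x = colk y].
  have : ~~ [forall x in exchange_set, forall y in exchange_set, (colk x == colk y) ==> (x == y)].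
    apply/negP => /forall_inP h.
    have : (#|colk @: exchange_set| <= #|'I_k|)%N by exact: max_card.
    rewrite card_in_imset ?card_exchange_set ?card_ord ?ltnn // => x y xC yC /eqP cxy.
    by apply/eqP; have /forall_inP/(_ y yC)/implyP/(_ cxy) := h x xC.
  case/forall_inPn=> x xC /forall_inPn[y yC]; rewrite negb_imply => /andP[/eqP cxy xy].
  by exists x, y.
transitivity ((-1) ^+ p1 * (-1) ^+ p2 *
    \sum_(s : {perm 'I_k + 'I_m} | perm_on exchange_set s)
      (-1) ^+ s * \prod_z g (v (s z)) (widen_ord kn (colk z))).
  rewrite mulr_sumr; apply: eq_bigr => s _; rewrite big_sumType /=.
  under eq_bigr do rewrite mxE.
  under [X in _ * (_ * (_ * X))]eq_bigr do rewrite mxE.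
  rewrite [in LHS]mulrACA [LHS]mulrCA; congr (_ * (_ * _)).
  congr (_ * _); apply: eq_bigr => j _; congr (g _ _).
  by apply: val_inj.
by rewrite (alternating_sum0 _ _ xC yC xy) ?mulr0 // cxy.
Qed.

(** The sign of s and the sign of the affected minor change together. *)
Lemma garnir_term_tperm g s x y : (x \in left_positions) = (y \in left_positions) ->
  garnir_term g (tperm x y * s)%g = garnir_term g s.
Proof.
have [->|xy] := eqVneq x y; first by rewrite tperm1 mul1g.
move=> xyL; rewrite /garnir_term odd_permM odd_tperm xy signr_addb expr1 mulN1r mulNr -mulrN.
congr (_ * _).
case: x y xyL xy => [i|j] [i'|j']; rewrite !inE //= => _ xy.
  rewrite -mulNr; congr (_ * _); last first.
    by apply: eq_tminor => j; rewrite permM tpermD.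
  rewrite (@eq_tminor _ _ _ _ _ _ ((fun i => v (s (inl i))) \o tperm i i')); last first.
    by move=> z /=; rewrite permM (inj_tperm _ _ _ inl_inj).
  by rewrite tminor_perm odd_tperm (inj_eq inl_inj) in xy *; rewrite xy expr1 mulN1r opprK.
rewrite -mulrN; congr (_ * _).
  by apply: eq_tminor => z; rewrite permM tpermD.
rewrite (@eq_tminor _ _ _ _ _ _ ((fun i => v (s (inr i))) \o tperm j j')); last first.
  by move=> z /=; rewrite permM (inj_tperm _ _ _ inr_inj).
by rewrite tminor_perm odd_tperm (inj_eq inr_inj) in xy *; rewrite xy expr1 mulN1r opprK.
Qed.

(** A permutation that preserves the two columns is undone by transpositions
    inside the columns, each of which fixes one more position. *)
Lemma garnir_term_stab g s : (forall x, (s x \in left_positions) = (x \in left_positions)) ->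
  garnir_term g s = garnir_term g 1%g.
Proof.
have [d] := ubnP #|[set z | s z != z]%SET|; elim: d s => // d IH s sd stab.
have [->//|s1] := eqVneq s 1%g.
have [z sz] : exists z, s z != z.
  apply/existsP; apply: contraNT s1; rewrite negb_exists => /forallP h.
  by apply/eqP/permP=> z; have := h z; rewrite negbK perm1 => /eqP.
pose y := (s^-1)%g z; have sy : s y = z by rewrite /y permKV.
have yz : y != z by apply: contraNneq sz => e; rewrite -{1}e sy.
have yL : (z \in left_positions) = (y \in left_positions) by rewrite -sy stab.
rewrite -(garnir_term_tperm g s yL); apply: IH; last first.
  by move=> x; rewrite permM stab; case: tpermP => [->|->|].
rewrite ltnS in sd; apply: leq_trans sd.
apply: proper_card; apply/properP; split.
  apply/fintype.subsetP => x; rewrite !inE permM; case: tpermP => [->|->|//].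
    by rewrite sy eqxx.
  by move=> _; rewrite sy eq_sym.
by exists z; rewrite !inE // permM tpermL sy eqxx.
Qed.

(** The threshold th separates the exchanged entries on the right from the
    larger exchanged entries on the left, so every genuine exchange brings
    smaller entries to the left. *)
Lemma exchange_sum_lt s (th : nat) : perm_on exchange_set s ->
  (forall i : 'I_k, l <= i -> th < v (inl i))%N ->
  (forall j : 'I_m, j <= l -> v (inr j) <= th)%N ->
  ~~ [forall x, (s x \in left_positions) == (x \in left_positions)] ->
  (\sum_(i < k) v (s (inl i)) < \sum_(i < k) v (inl i))%N.
Proof.
move=> sC vA vB nstab; set L := left_positions; set sL := (s @: L)%SET.
have sumL (f : 'I_k + 'I_m -> nat) : (\sum_(i < k) f (inl i) = \sum_(x in L) f x)%N.
  rewrite [RHS]big_mkcond big_sumType /= [X in (_ + X)%N]big1 ?addn0 => [|j _].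
    by apply: eq_bigr => i _; rewrite inE.
  by rewrite inE.
rewrite (sumL (fun x => v (s x) : nat)) (sumL (fun x => v x : nat)).
rewrite -(big_imset (fun x => v x : nat)) /=; last by move=> x y _ _; exact: perm_inj.
rewrite -/sL (big_setID L) /= [X in (_ < X)%N](big_setID sL) /= finset.setIC ltn_add2l.
have cLs : #|sL :\: L| = #|L :\: sL|.
  apply/eqP; rewrite -(eqn_add2l #|L :&: sL|) [in X in X == _]finset.setIC !cardsID.
  by rewrite card_imset //; exact: perm_inj.
have moved x : s x != x -> s x \in exchange_set.
  by move=> sx; rewrite (perm_closed _ sC); apply: contraNT sx => /(out_perm sC)->.
apply: (@leq_ltn_trans (#|sL :\: L| * th)%N).
  rewrite -sum_nat_const; apply: leq_sum => y; rewrite inE => /andP[yL /imsetP[x xL e]].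
  have : y \in exchange_set by rewrite e moved // -e; apply: contraNneq yL => ->.
  by move: yL; rewrite e !inE; case: (s x) => // j _; exact: vB.
have th_lt x : x \in L :\: sL -> (th < v x)%N.
  rewrite inE => /andP[xs xL].
  have : x \in exchange_set.
    rewrite -[x](permKV s) moved // permKV.
    by apply: contraNneq xs => e; apply/imsetP; exists x => //; rewrite {2}e permKV.
  by move: xL; rewrite !inE; case: x {xs} => // i _; exact: vA.
rewrite cLs -sum_nat_const; apply: (@leq_trans (\sum_(x in L :\: sL) th.+1)%N); last first.
  by apply: leq_sum => x; exact: th_lt.
rewrite !sum_nat_const ltn_pmul2l // -cLs card_gt0; apply: contraNneq nstab => e.
have sLe : sL = L.
  apply/eqP; rewrite finset.eqEcard -finset.setD_eq0 e eqxx /=.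
  by rewrite card_imset //; exact: perm_inj.
by apply/forallP=> x; rewrite -{1}/L -{1}sLe mem_imset //; exact: perm_inj.
Qed.

End Garnir.

(** * The straightening law *)

Section Weight.
Variable n : nat.
Implicit Types A B : {set 'I_n}.

(** Small entries weigh much, and the offset n * n makes any larger set heavier
    than any smaller one. *)
Definition wt A : nat := (\sum_(x in A) (n * n - x))%N.

Lemma sum_subn (I : finType) (P : pred I) (M : nat) (f : I -> nat) :
  (forall i, f i <= M)%N ->
  (\sum_(i | P i) (M - f i) + \sum_(i | P i) f i = #|P| * M)%N.
Proof.
by move=> fM; rewrite -big_split -sum_nat_const; apply: eq_bigr => i _; exact: subnK.
Qed.

Lemma ord_le_sqr (x : 'I_n) : (x <= n * n)%N.
Proof. by apply: leq_trans (ltnW (ltn_ord x)) _; rewrite leq_pmulr // (leq_ltn_trans _ (ltn_ord x)). Qed.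

Lemma wt_le A : (wt A <= #|A| * (n * n))%N.
Proof.
by rewrite -sum_nat_const; apply: leq_sum => x _; rewrite leq_subr.
Qed.

Lemma wt_card A B : (#|A| < #|B|)%N -> (wt A < wt B)%N.
Proof.
move=> AB; apply: leq_ltn_trans (wt_le A) _.
have : (wt B + \sum_(x in B) x = #|B| * (n * n))%N.
  exact: (@sum_subn _ (mem B) (n * n) (fun x : 'I_n => x) (fun x => ord_le_sqr x)).
move=> e.
have : (\sum_(x in B) x <= #|B| * n.-1)%N.
  by rewrite -sum_nat_const; apply: leq_sum => x _; have := ltn_ord x; lia.
have := card_set_ord_le B.
move: e AB; move: #|B| #|A| => b a e ab bn lesum.
have h1 : (a * (n * n) + n * n <= b * (n * n))%N by rewrite -mulSnr leq_mul2r ab orbT.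
have h2 : (b * n.-1 < n * n)%N.
  apply: (@leq_ltn_trans (n * n.-1)); first by rewrite leq_mul2r bn orbT.
  by rewrite ltn_pmul2l; lia.
lia.
Qed.

End Weight.

Section Straightening.
Variables (R : realType) (n : nat).
Implicit Types (A B : pindex n) (m : pmonom n).

(** The permutations that preserve both columns contribute a positive multiple
    of the given product to the Garnir sum. All others make the heavier column
    heavier still, or repeat an entry and contribute 0. *)
Lemma garnir_relation A B : (wt (val B) <= wt (val A))%N -> ~~ ple (val A) (val B) ->
  exists (I : finType) (Q : pred I) (c : I -> R[i]) (F : I -> pindex n * pindex n),
    (forall i, Q i -> [/\ #|val (F i).1| = #|val A|, #|val (F i).2| = #|val B|,
       (wt (val (F i).1) + wt (val (F i).2) = wt (val A) + wt (val B))%N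
       & (wt (val A) < wt (val (F i).1))%N]) /\
    (forall g, pcoord g A * pcoord g B =
       \sum_(i | Q i) c i * (pcoord g (F i).1 * pcoord g (F i).2)).
Proof.
move=> BA /forallPn[l0]; rewrite -ltnNge; set l := (l0 : nat) => lAB.
pose k := #|val A|; pose m := #|val B|.
have lm : (l < m)%N by rewrite -elt_ltn_card (leq_trans lAB) // elt_le.
have mk : (m <= k)%N.
  by rewrite leqNgt; apply/negP => /wt_card; rewrite ltnNge BA.
pose kn : (k <= n)%N := card_set_ord_le (val A).
pose v (x : 'I_k + 'I_m) : 'I_n :=
  match x with inl i => enum_val i | inr j => enum_val j end.
pose T := {perm 'I_k + 'I_m}.
pose tA (s : T) i := v (s (inl i)); pose tB (s : T) j := v (s (inr j)).
pose stab (s : T) := [forall x, (s x \in left_positions k m) == (x \in left_positions k m)].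
pose C := exchange_set k m l.
pose Q (s : T) := [&& perm_on C s, ~~ stab s, injectiveb (tA s) & injectiveb (tB s)].
have vl (i : 'I_k) : (l <= i)%N -> (elt (val B) l < v (inl i))%N.
  move=> li; apply: leq_trans lAB _; rewrite /= elt_enum_val.
  move: li; rewrite leq_eqVlt => /orP[/eqP->//|li].
  by apply/ltnW/elt_mono; rewrite li /= (ltn_ord i).
have vr (j : 'I_m) : (j <= l)%N -> (v (inr j) <= elt (val B) l)%N.
  rewrite /= elt_enum_val leq_eqVlt => /orP[/eqP->//|jl].
  by apply/ltnW/elt_mono; rewrite jl.
have pick s : exists cF : R[i] * (pindex n * pindex n), Q s ->
    [/\ #|val cF.2.1| = #|val A|, #|val cF.2.2| = #|val B|,
       (wt (val cF.2.1) + wt (val cF.2.2) = wt (val A) + wt (val B))%N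
       & (wt (val A) < wt (val cF.2.1))%N] /\
    (forall g, garnir_term kn mk v g s = cF.1 * (pcoord g cF.2.1 * pcoord g cF.2.2)).
  case: (boolP (Q s)) => [|_]; last by exists (0, (A, B)).
  case/and4P=> sC nst /injectiveP tAi /injectiveP tBi.
  have cA : #|[set tA s i | i in 'I_k]%SET| = k by rewrite card_imset // card_ord.
  have cB : #|[set tB s i | i in 'I_m]%SET| = m by rewrite card_imset // card_ord.
  have pA : (0 < #|[set tA s i | i in 'I_k]%SET| < n)%N by rewrite cA (valP A).
  have pB : (0 < #|[set tB s i | i in 'I_m]%SET| < n)%N by rewrite cB (valP B).
  pose A' := pindex_of pA; pose B' := pindex_of pB.
  have tAA i : tA s i \in val A' by rewrite imset_f.
  have tBB i : tB s i \in val B' by rewrite imset_f.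
  have [c1 e1] := @tminor_inj R n k kn (tA s) A' tAi cA tAA.
  have [c2 e2] := @tminor_inj R n m (leq_trans mk kn) (tB s) B' tBi cB tBB.
  exists ((-1) ^+ s * (c1 * c2), (A', B')) => _ /=; split; last first.
    by move=> g; rewrite /garnir_term e1 e2 -[in RHS]mulrA -[in RHS]mulrACA.
  have wA' : wt (val A') = (\sum_i (n * n - tA s i))%N.
    by rewrite /wt big_imset //= => x y _ _; exact: tAi.
  have wB' : wt (val B') = (\sum_i (n * n - tB s i))%N.
    by rewrite /wt big_imset //= => x y _ _; exact: tBi.
  have wA : wt (val A) = (\sum_i (n * n - v (inl i)))%N by rewrite /wt big_enum_val.
  have wB : wt (val B) = (\sum_i (n * n - v (inr i)))%N by rewrite /wt big_enum_val.
  split => //.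
    rewrite wA' wB' wA wB.
    have := big_sumType (I1 := 'I_k) (I2 := 'I_m) addn predT (fun x => n * n - v x)%N.
    move=> /= <-; rewrite (reindex_inj (@perm_inj _ s)) /=.
    by rewrite big_sumType.
  have := exchange_sum_lt sC vl vr nst.
  have := @sum_subn _ predT (n * n) (fun i => tA s i : nat) (fun i => ord_le_sqr _).
  have := @sum_subn _ predT (n * n) (fun i : 'I_k => v (inl i) : nat) (fun i => ord_le_sqr _).
  rewrite wA' wA; rewrite -/(tA s).
  set a := bigop _ _ _; set b := bigop _ _ _; set a' := bigop _ _ _; set b' := bigop _ _ _.
  by lia.
have [cF cFP] := fin_all_exists pick.
(* The product of A and B occurs #|S1| times in the Garnir sum. *)
pose S1 := [pred s : T | perm_on C s && stab s].
have S1_1 : S1 1%g by rewrite /= perm_on1; apply/forallP=> x; rewrite perm1.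
have N0 : (#|S1|%:R : R[i]) != 0.
  by rewrite pnatr_eq0 -lt0n; apply/card_gt0P; exists 1%g.
exists T, Q, (fun s => - (cF s).1 / #|S1|%:R), (fun s => (cF s).2); split.
  by move=> s /cFP[].
move=> g; apply: (mulfI N0).
have := garnir_sum0 kn mk lm v g; rewrite (bigID stab) /=.
have -> : \sum_(s | perm_on (exchange_set k m l) s && stab s) garnir_term kn mk v g s =
    #|S1|%:R * (pcoord g A * pcoord g B).
  rewrite mulr_natl -sumr_const; apply: eq_bigr => s /andP[_ /forallP st].
  rewrite (garnir_term_stab _ _ _ _ (fun x => eqP (st x))) /garnir_term odd_perm1 mul1r.
  congr (_ * _).
    by apply: tminor_mono => // r; rewrite perm1 elt_enum_val.
  by apply: tminor_mono => // r; rewrite perm1 elt_enum_val.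
rewrite (bigID (fun s => injectiveb (tA s) && injectiveb (tB s))) /=.
rewrite [X in _ + (_ + X)]big1 ?addr0 => [|s /andP[_]]; last first.
  rewrite negb_and /garnir_term => /orP[] ni.
    by rewrite (tminor_noninj kn g ni) mul0r mulr0.
  by rewrite (tminor_noninj _ g ni) !mulr0.
move/eqP; rewrite addr_eq0 => /eqP->; rewrite -sumrN mulr_sumr.
apply: eq_big => [s|s Qs]; first by rewrite /Q -!andbA.
have {}Qs : Q s by rewrite /Q -!andbA in Qs *.
have [_ ->] := cFP s Qs.
rewrite !mulNr mulrN; congr (- _); rewrite [RHS]mulrA; congr (_ * _).
by rewrite mulrCA divff // mulr1.
Qed.

Definition straight m := exists2 h : pring R n,
  {in msupp h, forall s, standard s} & pideal ('X_[m] - h).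

Lemma straight_standard m : standard m -> straight m.
Proof.
move=> sm; exists 'X_[m]; last by rewrite subrr; exact: pideal0.
by move=> s; rewrite msuppX inE => /eqP->.
Qed.

Lemma multidegD m m' : multideg (m + m')%MM = [ffun k => multideg m k + multideg m' k]%N.
Proof.
by apply/ffunP=> k; rewrite !ffunE -big_split; apply: eq_bigr => A _; rewrite mnmDE.
Qed.

Lemma multideg1 A : multideg U_(enum_rank A)%MM = [ffun k : 'I_n => (#|val A| == k)%N : nat].
Proof.
apply/ffunP=> k; rewrite !ffunE big_mkcond (bigD1 A) //= -/(mult _ A) mult1 eqxx.
rewrite big1 ?addn0 => [|B BA]; first by case: ifP.
by rewrite -/(mult _ B) mult1 (eq_sym A) (negPf BA); case: ifP.
Qed.

(** A sum of squares grows when weight moves from a lighter to a heavier column,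
    as it does in each step of straightening. *)
Definition energy m := (\sum_A mult m A * wt (val A) ^ 2)%N.

Lemma energyD m m' : energy (m + m')%MM = (energy m + energy m')%N.
Proof. by rewrite -big_split; apply: eq_bigr => A _; rewrite multD mulnDl. Qed.

Lemma energy1 A : energy U_(enum_rank A)%MM = (wt (val A) ^ 2)%N.
Proof. exact: sum_mult1. Qed.

Lemma sum_mult m : (\sum_A mult m A)%N = mdeg m.
Proof.
rewrite mdegE (reindex (@enum_rank (pindex n))) //.
by exists enum_val => i _; rewrite ?enum_rankK ?enum_valK.
Qed.

Lemma energy_le m : (energy m <= mdeg m * (n * (n * n)) ^ 2)%N.
Proof.
rewrite -sum_mult big_distrl; apply: leq_sum => A _.
rewrite leq_mul2l leq_exp2r // (leq_trans (wt_le _)) ?orbT //.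
by rewrite leq_mul2r card_set_ord_le orbT.
Qed.

Lemma mult_split m A B : A != B -> (0 < mult m A)%N -> (0 < mult m B)%N ->
  exists m', m = (U_(enum_rank A) + U_(enum_rank B) + m')%MM.
Proof.
move=> AB mA mB; exists (m - (U_(enum_rank A) + U_(enum_rank B)))%MM.
rewrite addmC submK //; apply/mnm_lepP => i.
rewrite -(enum_valK i); move: (enum_val i) => D.
rewrite -[X in (X <= _)%N]/(mult _ D) multD !mult1.
have [eA|_] := eqVneq A D; last by case: eqP => [<-|].
by have [eB|_] := eqVneq B D; [move: AB; rewrite eA eB eqxx|rewrite -eA].
Qed.

(** In a monomial that is not standard, take two incomparable variables with the
    heavier one on the left and apply a Garnir relation to them: all new
    monomials have the same degree and more energy, which is bounded. *)
Theorem straightening m : straight m.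
Proof.
have [d] := ubnP (mdeg m * (n * (n * n)) ^ 2 - energy m)%N.
elim: d m => // d IH m dm.
have [sm|] := boolP [forall A : pindex n, forall B : pindex n,
    (0 < mult m A)%N ==> (0 < mult m B)%N ==> ple (val A) (val B) || ple (val B) (val A)].
  apply: straight_standard => A B mA mB.
  by have /forallP/(_ B) := forallP sm A; rewrite mA mB.
case/forallPn=> A0 /forallPn[B0]; rewrite !negb_imply negb_or.
case/and4P=> mA0 mB0 nAB0 nBA0.
have {A0 B0 mA0 mB0 nAB0 nBA0} [A [B [mA mB wBA nAB]]] : exists A B,
    [/\ (0 < mult m A)%N, (0 < mult m B)%N, (wt (val B) <= wt (val A))%N
      & ~~ ple (val A) (val B)].
  by have [w|/ltnW w] := leqP (wt (val B0)) (wt (val A0)); [exists A0, B0|exists B0, A0].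
have AB : A != B by apply: contraNneq nAB => ->; exact: ple_refl.
have [m' em] := mult_split AB mA mB.
have [I [Q [c [F [QF eF]]]]] := garnir_relation wBA nAB.
pose mm i := (U_(enum_rank (F i).1) + U_(enum_rank (F i).2) + m')%MM.
have mmdeg i : Q i -> mdeg (mm i) = mdeg m.
  by move=> _; rewrite em !mdegD !mdeg1.
have H i : exists h : pring R n, Q i -> {in msupp h, forall s, standard s} /\ pideal ('X_[mm i] - h).
  have [Qi|_] := boolP (Q i); last by exists 0.
  have [|h sh Ih] := IH (mm i); last by exists h.
  have [_ _ wF wA] := QF i Qi.
  have eE : (energy m < energy (mm i))%N.
    rewrite em !energyD !energy1 ltn_add2r.
    by move: wF wA wBA; move: (wt _) (wt _) (wt _) (wt _) => a b a' b' *; nia.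
  (* All monomials mm i have the degree of m, so they share its energy bound. *)
  have := energy_le (mm i); rewrite mmdeg // => eM.
  by move: dm eE eM; move: (energy _) (energy _) (mdeg m * _)%N => x y z; lia.
have [h hP] := fin_all_exists H.
exists (\sum_(i | Q i) c i *: h i).
  move=> s /mem_msupp_sum[i Qi /msuppZ_le].
  by have [sh _] := hP i Qi; exact: sh.
have -> : 'X_[m] - \sum_(i | Q i) c i *: h i =
    ('X_[m] - \sum_(i | Q i) c i *: 'X_[mm i]) + \sum_(i | Q i) c i *: ('X_[mm i] - h i).
  under [X in _ = _ + X]eq_bigr do rewrite scalerBr.
  by rewrite sumrB addrA subrK.
apply: pidealD; last first.
  by apply: pideal_sum => i /hP[_ Ih]; exact: pidealZ.
apply: (@pideal_multihomog _ _ (multideg m)) => [s|g].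
  move/msuppB_le; rewrite mem_cat msuppX inE => /orP[/eqP->//|].
  move/mem_msupp_sum => [i Qi /msuppZ_le].
  rewrite msuppX inE => /eqP->; have [cA cB _ _] := QF i Qi.
  by rewrite em !multidegD !multideg1 cA cB.
rewrite mevalB (raddf_sum (meval (ppoint g))) /= em !mpolyXD !mevalM !meval_var eF mulr_suml.
apply/eqP; rewrite subr_eq0; apply/eqP/eq_bigr => i _.
by rewrite mevalZ /mm !mpolyXD !mevalM !meval_var [RHS]mulrA.
Qed.

End Straightening.

(** * Lowest terms of the minors of a unitriangular matrix *)

Section Monge.
Variable R : realDomainType.

(** The defect of the inequality on a rectangle is the sum of the defects on its
    unit cells. The condition l' <= j keeps all these cells above the diagonal. *)
Lemma monge_rect (e : nat -> nat -> R) (n : nat) :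
  (forall i j, (i < j)%N -> (j.+1 < n)%N ->
     e i j + e i.+1 j.+1 < e i j.+1 + e i.+1 j) ->
  forall l l' j j', (l < l')%N -> (l' <= j)%N -> (j < j')%N -> (j' < n)%N ->
     e l j + e l' j' < e l j' + e l' j.
Proof.
move=> loc.
have row l j j' : (l < j)%N -> (j < j')%N -> (j' < n)%N ->
    e l j + e l.+1 j' < e l j' + e l.+1 j.
  move=> lj; elim: j' => // j' IH; rewrite ltnS leq_eqVlt => /orP[/eqP<-|jj'] j'n.
    by apply: loc => //; lia.
  have h1 : e l j' + e l.+1 j'.+1 < e l j'.+1 + e l.+1 j' by apply: loc => //; lia.
  have h2 := IH jj' (ltnW j'n).
  by lra.
move=> l l' j j'; elim: l' => // l' IH; rewrite ltnS leq_eqVlt => /orP[/eqP<-|ll'] lj jj' j'n.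
  exact: row.
have h1 := IH ll' (ltnW lj) jj' j'n.
have h2 := row l' j j' lj jj' j'n.
by lra.
Qed.

(** At the first point x that s moves, the value x is taken later and s x > x. *)
Lemma perm_inversion k (s : 'S_k) : s != 1%g ->
  exists x y : 'I_k, (x < y)%N /\ (s y < s x)%N.
Proof.
move=> s1; have [x0 sx0] : exists x, s x != x.
  apply/existsP; apply: contraNT s1; rewrite negb_exists => /forallP h.
  by apply/eqP/permP=> z; have := h z; rewrite negbK perm1 => /eqP.
have [x sx minx] := @arg_minnP _ x0 (fun x => s x != x) (fun x : 'I_k => x : nat) sx0.
have fixed (y : 'I_k) : (y < x)%N -> s y = y.
  by move=> yx; apply/eqP; apply: contraTT yx => /minx; rewrite -leqNgt.
exists x, ((s^-1)%g x); rewrite permKV; split.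
  rewrite ltnNge leq_eqVlt negb_or; apply/andP; split.
    by apply: contraNneq sx => /val_inj e; rewrite -{1}e permKV.
  apply/negP => /fixed; rewrite permKV => e.
  by move: sx; rewrite {1}e permKV eqxx.
rewrite ltnNge leq_eqVlt negb_or sx /=.
by apply/negP=> /fixed /perm_inj e; rewrite e eqxx in sx.
Qed.

(** Removing an inversion strictly lowers the weight, by the Monge inequality;
    so a permutation of least weight has no inversion. *)
Lemma diagonal_min (e : nat -> nat -> R) (n k : nat) (t : 'I_k -> nat) :
  (forall i j, (i < j)%N -> (j.+1 < n)%N ->
     e i j + e i.+1 j.+1 < e i j.+1 + e i.+1 j) ->
  (forall r s : 'I_k, (r < s)%N -> (t r < t s)%N) -> (forall r, (t r < n)%N) ->
  forall s : 'S_k, (forall r, (s r <= t r)%N) -> s != 1%g ->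
    \sum_(r < k) e r (t r) < \sum_(r < k) e (s r) (t r).
Proof.
move=> loc tmono tn.
pose W (s : 'S_k) := \sum_(r < k) e (s r) (t r).
pose valid (s : 'S_k) := [forall r, (s r <= t r)%N].
have swap s : valid s -> s != 1%g -> exists2 s', valid s' & W s' < W s.
  move=> /forallP vs /perm_inversion[x [y [xy syx]]].
  have nxy : x != y by rewrite -val_eqE /= ltn_eqF.
  exists (tperm x y * s)%g.
    apply/forallP=> r; rewrite permM; case: tpermP => [->|->|_ _] //.
      exact: leq_trans (ltnW syx) (vs x).
    by apply: leq_trans (vs x) _; apply/ltnW/tmono.
  rewrite /W (bigD1 x) //= (bigD1 y) 1?eq_sym //=.
  rewrite [X in _ < X](bigD1 x) //= [X in _ < _ + X](bigD1 y) 1?eq_sym //=.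
  rewrite !permM tpermL tpermR.
  rewrite (eq_bigr (fun r => e (s r) (t r))) => [|r /andP[rx ry]]; last first.
    by rewrite permM tpermD // eq_sym.
  rewrite !addrA ltrD2r [X in _ < X]addrC.
  by have := monge_rect loc syx (vs x) (tmono _ _ xy) (tn y); lra.
move=> s vs s1; have {}vs : valid s by apply/forallP.
have [s' vs' ltW] := swap s vs s1.
apply: le_lt_trans ltW.
have [s0 vs0 min0] := arg_minP W vs'.
have [e0|/(swap s0 vs0)[s2 /min0 h]] := eqVneq s0 1%g; last by rewrite ltNge h.
have := min0 s' vs'; rewrite {1}/W e0.
by under eq_bigr do rewrite perm1.
Qed.

End Monge.

Section LeadingForms.
Variables (R : realType) (n : nat) (a : Theta R n).
Notation zring := {mpoly R[i][#|{: pos n}|]}.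
Notation zmon := 'X_{1..#|{: pos n}|}.
Implicit Types (mu nu : zmon) (P Q E : zring) (A : pindex n) (m : pmonom n).

(** The weight of a monomial in the z_(l,j), when z_(l,j) has weight a_(l,j). *)
Definition zwt mu : R := \sum_(p : pos n) a p *+ mu (enum_rank p).

Lemma zwtD mu nu : zwt (mu + nu)%MM = zwt mu + zwt nu.
Proof. by rewrite -big_split; apply: eq_bigr => p _; rewrite mnmDE mulrnDr. Qed.

Lemma zwt0 : zwt 0%MM = 0.
Proof. by rewrite /zwt big1 // => p _; rewrite mnm0E. Qed.

Definition above (w : R) P := forall mu, mu \in msupp P -> w < zwt mu.

Lemma aboveD w P Q : above w P -> above w Q -> above w (P + Q).
Proof. by move=> hP hQ mu /msuppD_le; rewrite mem_cat => /orP[/hP|/hQ]. Qed.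

Lemma aboveM w w' P Q : (forall mu, mu \in msupp P -> w < zwt mu) ->
  (forall mu, mu \in msupp Q -> w' <= zwt mu) -> above (w + w') (P * Q).
Proof.
move=> hP hQ mu /msuppM_le /allpairsP[[m1 m2] [/= /hP h1 /hQ h2 ->]].
by rewrite zwtD ltr_leD.
Qed.

(** X^mu is the part of P of lowest weight. *)
Definition leads mu P := above (zwt mu) (P - 'X_[mu]).

Lemma leads_le mu P nu : leads mu P -> nu \in msupp P -> zwt mu <= zwt nu.
Proof.
move=> lP; rewrite -[P](subrK 'X_[mu]) => /msuppD_le; rewrite mem_cat.
by case/orP=> [/lP/ltW//|]; rewrite msuppX inE => /eqP->.
Qed.

Lemma leadsM mu nu P Q : leads mu P -> leads nu Q -> leads (mu + nu)%MM (P * Q).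
Proof.
move=> lP lQ; rewrite /leads zwtD mpolyXD.
have -> : P * Q - 'X_[mu] * 'X_[nu] = (P - 'X_[mu]) * Q + (Q - 'X_[nu]) * 'X_[mu].
  by ring.
apply: aboveD; first by apply: aboveM => // x; exact: leads_le.
rewrite addrC; apply: aboveM => // x.
by rewrite msuppX inE => /eqP->.
Qed.

Lemma leads1 : leads 0%MM 1.
Proof. by rewrite /leads mpolyX0 subrr => mu; rewrite msupp0. Qed.

Lemma leads_prod (I : Type) (r : seq I) (f : I -> zmon) (F : I -> zring) :
  (forall i, leads (f i) (F i)) -> leads (\sum_(i <- r) f i)%MM (\prod_(i <- r) F i).
Proof.
move=> h; elim/big_rec2: _ => [|i P mu _ IH]; first exact: leads1.
exact: leadsM.
Qed.

Lemma leads_exp mu P k : leads mu P -> leads (mu *+ k)%MM (P ^+ k).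
Proof.
move=> lP; elim: k => [|k IH]; first by rewrite mulm0n expr0; exact: leads1.
by rewrite exprS mulmS; exact: leadsM.
Qed.

Lemma leads_coef mu P nu : leads mu P -> zwt nu <= zwt mu -> P@_nu = (mu == nu)%:R.
Proof.
move=> lP le; rewrite -mcoeffX; apply/eqP; rewrite -subr_eq0 -mcoeffB mcoeff_eq0.
by apply/negP => /lP; rewrite ltNge le.
Qed.

(** The exponent of z_(l,j), where z_(l,l) stands for 1. *)
Definition umon (l j : nat) : zmon :=
  [multinom ((l == (val (enum_val p)).1 :> nat) && (j == (val (enum_val p)).2 :> nat) : nat)
   | p < #|{: pos n}|].

Lemma zwt_umon l j : zwt (umon l j) = entry a l j.
Proof.
rewrite /zwt /entry [RHS]big_mkcond; apply: eq_bigr => p _.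
by rewrite mnmE enum_rankK /= (eq_sym l) (eq_sym j); case: ifP.
Qed.

(** The generic lower unitriangular matrix. *)
Definition zmat : 'M[zring]_n :=
  \matrix_(j, l) (if (l <= j)%N then 'X_[umon l j] else 0).

Lemma umon_diag l : umon l l = 0%MM.
Proof.
apply/mnmP=> p; rewrite mnmE mnm0E; have := valP (enum_val p).
by case: eqP => // ->; case: eqP => // ->; rewrite ltnn.
Qed.

Definition zpcoord A : zring :=
  \det (\matrix_(r < #|val A|, c < #|val A|)
          zmat (enum_val r) (widen_ord (card_set_ord_le (val A)) c)).

Lemma det_zmat x : \det (map_mx (meval x) zmat) = 1.
Proof.
rewrite det_trig; last first.
  apply/is_trig_mxP => i j ij; rewrite !mxE leqNgt ij /=; exact: raddf0.
by rewrite big1 // => i _; rewrite !mxE leqnn umon_diag mpolyX0; exact: rmorph1.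
Qed.

Lemma meval_zpcoord x A : (zpcoord A).@[x] = pcoord (map_mx (meval x) zmat) A.
Proof.
rewrite /zpcoord /pcoord -det_map_mx; congr (\det _).
by apply/matrixP=> r c; rewrite !mxE.
Qed.

Lemma Tdeg1E A : Tdeg U_(enum_rank A)%MM = (\sum_(r < #|val A|) umon r (elt (val A) r))%MM.
Proof.
apply/mnmP=> p; rewrite Tdeg1 mnm_sumE.
set l := (val (enum_val p)).1; set j := (val (enum_val p)).2.
case: (ltnP l #|val A|) => lA.
  rewrite (bigD1 (Ordinal lA)) //= mnmE eqxx /= big1 ?addn0 // => r.
  by rewrite -val_eqE /= mnmE => /negPf->.
rewrite elt_default // gtn_eqF // big1 // => r _; rewrite mnmE.
by rewrite ltn_eqF // (leq_trans (ltn_ord r)).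
Qed.

Hypothesis strict : forall i j, (i < j)%N -> (j.+1 < n)%N ->
  entry a i j + entry a i.+1 j.+1 < entry a i j.+1 + entry a i.+1 j.

(** The Leibniz terms that use an entry above the diagonal of the matrix vanish;
    among the others, [diagonal_min] singles out the identity. *)
Lemma leads_zpcoord A : leads (Tdeg U_(enum_rank A)%MM) (zpcoord A).
Proof.
set k := #|val A|.
have zterm (s : 'S_k) : \prod_(r < k)
    (\matrix_(r < k, c < k) zmat (enum_val r)
       (widen_ord (card_set_ord_le (val A)) c)) r (s r) =
    if [forall r : 'I_k, (s r <= elt (val A) r)%N]
    then 'X_[(\sum_(r < k) umon (s r) (elt (val A) r))%MM] else 0.
  case: ifP => [/forallP h|/negbT/forallPn[r h]].
    rewrite -mprodXE; apply: eq_bigr => r _; rewrite !mxE /= elt_enum_val.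
    by rewrite h.
  by rewrite (bigD1 r) //= !mxE /= elt_enum_val (negPf h) mul0r.
have zw (s : 'S_k) : zwt (\sum_(r < k) umon (s r) (elt (val A) r))%MM =
    \sum_(r < k) entry a (s r) (elt (val A) r).
  rewrite (big_morph zwt zwtD zwt0); apply: eq_bigr => r _.
  exact: zwt_umon.
rewrite /leads /zpcoord /determinant (bigD1 1%g) //=.
have -> : Tdeg U_(enum_rank A)%MM =
    (\sum_(r < k) umon ((1 : 'S_k)%g r) (elt (val A) r))%MM.
  by rewrite Tdeg1E; apply: eq_bigr => r _; rewrite perm1.
rewrite zterm ifT ?odd_perm1 ?mul1r; last first.
  apply/forallP=> r; rewrite perm1 elt_id_le // ltnW // (leq_trans (ltn_ord r)) //.
  exact: card_set_ord_le.
rewrite addrAC subrr add0r => mu /mem_msupp_sum[s s1].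
rewrite zterm; case: ifP => [/forallP h|_]; last by rewrite mulr0 msupp0.
rewrite mulr_sign (fun_if (fun p => mu \in msupp p)) (perm_mem (msuppN _)) if_same.
rewrite msuppX inE => /eqP->.
rewrite !zw; under eq_bigr do rewrite perm1.
apply: (diagonal_min strict) => //= [r r' rr'|r].
  by apply: elt_mono; rewrite rr' ltn_ord.
exact: elt_lt.
Qed.

Definition zmonom m : zring := \prod_j zpcoord (enum_val j) ^+ m j.

Lemma TdegD m m' : Tdeg (m + m')%MM = (Tdeg m + Tdeg m')%MM.
Proof.
apply/mnmP=> p; rewrite mnmDE !mnmE -big_split; apply: eq_bigr => A _.
by rewrite multD mulnDl.
Qed.

Lemma Tdeg0 : Tdeg (0%MM : pmonom n) = 0%MM.
Proof. by apply/mnmP=> p; rewrite mnmE mnm0E big1 // => A _; rewrite /mult mnm0E. Qed.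

Lemma leads_zmonom m : leads (Tdeg m) (zmonom m).
Proof.
have -> : Tdeg m = (\sum_j (Tdeg U_(j) *+ m j))%MM.
  rewrite {1}[m]multinomUE_id (big_morph _ TdegD Tdeg0); apply: eq_bigr => j _.
  by elim: (m j) => [|k IH]; rewrite ?mulm0n ?Tdeg0 // !mulmS TdegD IH.
apply: leads_prod => j; apply: leads_exp.
by have := @leads_zpcoord (enum_val j); rewrite enum_valK.
Qed.

Lemma meval_zmonom x m :
  (zmonom m).@[x] = ('X_[m] : pring R n).@[ppoint (map_mx (meval x) zmat)].
Proof.
rewrite rmorph_prod mevalX; apply: eq_bigr => j _.
by rewrite rmorphXn /= meval_zpcoord.
Qed.

Lemma TvecE A (p : pos n) : Tvec R A p = (elt (val A) (val p).1 == (val p).2 :> nat)%:R.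
Proof.
rewrite ffunE; congr (nat_of_bool _)%:R; apply/existsP/eqP => [[l /andP[/eqP el /eqP ev]]|e].
  by rewrite -el -elt_enum_val ev.
have lA : ((val p).1 < #|val A|)%N by rewrite -elt_ltn_card e.
exists (Ordinal lA); rewrite eqxx /=; apply/eqP/val_inj => /=.
by rewrite elt_enum_val /= e.
Qed.

Lemma grad_sigma m : grad (sigma a) m = zwt (Tdeg m).
Proof.
rewrite /grad /zwt; under eq_bigr do rewrite ffunE -sumrMnl.
rewrite exchange_big; apply: eq_bigr => p _; rewrite mnmE -sumrMnr.
apply: eq_bigr => A _; rewrite enum_rankK TvecE mulnC mulrnA.
by rewrite mulr_natr.
Qed.

End LeadingForms.

(** * The toric ideal and initial parts *)

Section ToricIdeal.
Variables (R : realType) (n : nat).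
Implicit Types (f p : pring R n) (m : pmonom n) (S : Xi R n).

Definition samekey m m' := (multideg m == multideg m') && (Tdeg m == Tdeg m').

(** The multihomogeneous kernel of X_A |-> z^T(A), as a condition on the
    coefficients. *)
Definition toric p := forall m0 : pmonom n,
  coefsum (fun m => (samekey m m0)%:R) p = 0.

(** The interior of K. As entry a i.+1 i.+1 is 0, the case j = i + 1 is
    inequality (a), and the others are inequality (b). *)
Definition strictK (a : Theta R n) := forall i j, (i < j)%N -> (j.+1 < n)%N ->
  entry a i j + entry a i.+1 j.+1 < entry a i j.+1 + entry a i.+1 j.

Lemma coefsum_init F S f : coefsum F (init_part S f) =
  \sum_(m <- msupp f | all (fun m' => grad S m <= grad S m') (msupp f)) f@_m * F m.
Proof. by rewrite coefsum_sum; apply: eq_bigr => m _; rewrite coefsumZ coefsumX. Qed.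

(** Substitute the minors of [zmat] into a multihomogeneous part of f: the result
    vanishes identically. Its coefficients at the monomials whose weight is the
    least grade of f only see the leading monomials of the minors, so they are
    the coefficient sums that define [toric]. *)
Lemma init_part_toric (a : Theta R n) f :
  strictK a -> pideal f -> toric (init_part (sigma a) f).
Proof.
move=> sa If m0; rewrite coefsum_init; set S := sigma a.
pose ismin m := all (fun m' => grad S m <= grad S m') (msupp f).
have [/hasP[m1 m1f /andP[min1 key1]]|/hasPn none] :=
    boolP (has (fun m => ismin m && samekey m m0) (msupp f)); last first.
  rewrite big_seq_cond big1 // => m /andP[mf minm].
  by have := none m mf; rewrite /ismin minm /= => /negPf->; rewrite mulr0.
have /andP[/eqP ed /eqP et] := key1.
pose d := multideg m0.
pose h := \sum_(m <- msupp f | multideg m == d) f@_m *: zmonom R m.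
have h0 : h = 0.
  apply: mpoly_eq0 => x; rewrite -[RHS](If d _ (det_zmat x)).
  rewrite meval_multihomog /coefsum raddf_sum /= big_mkcond; apply: eq_bigr => m _.
  by rewrite mevalZ meval_zmonom; case: eqP; rewrite ?mul1r ?mul0r ?mulr0.
have := mcoeff0 (R[i]) (Tdeg m0); rewrite -h0 raddf_sum /= => eh.
rewrite -[RHS]eh.
rewrite [LHS]big_mkcond [RHS]big_mkcond /= [LHS]big_seq [RHS]big_seq.
apply: eq_bigr => m mf; rewrite mcoeffZ.
(* So X^(Tdeg m0) can only be the leading monomial of the image of X^m. *)
have min_m0 : zwt a (Tdeg m0) <= zwt a (Tdeg m).
  by rewrite -et -!grad_sigma; exact: (allP min1).
rewrite (leads_coef (@leads_zmonom _ _ a sa m) min_m0) /samekey -/d.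
case: (multideg m == d); rewrite /= ?mulr0 ?if_same //.
case: eqP => [e|_]; last by rewrite !mulr0 if_same.
rewrite ifT //; apply/allP => m' m'f.
by rewrite /S !grad_sigma e -et -!grad_sigma; exact: (allP min1).
Qed.

End ToricIdeal.

(** * The initial ideal at an interior point *)

Section InitialIdealOfInterior.
Variables (R : realType) (n : nat).
Implicit Types (f p q : pring R n) (m s t : pmonom n) (S : Xi R n) (a : Theta R n).

Lemma samekey_refl m : samekey m m.
Proof. by rewrite /samekey !eqxx. Qed.

Lemma samekey_sym m t : samekey m t = samekey t m.
Proof. by rewrite /samekey (eq_sym (multideg m)) (eq_sym (Tdeg m)). Qed.

Lemma samekey_trans : transitive (@samekey n).
Proof.
by move=> x y z /andP[/eqP d1 /eqP t1] /andP[/eqP d2 /eqP t2]; rewrite /samekey d1 d2 t1 t2 !eqxx.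
Qed.

Lemma toric_lin c p q : toric p -> toric q -> toric (c *: p + q).
Proof. by move=> tp tq m0; rewrite coefsum_lin tp tq mulr0 addr0. Qed.

Lemma toric0 : toric (0 : pring R n).
Proof. by move=> m0; rewrite coefsum0. Qed.

Lemma toric_monomial_free : monomial_free (@toric R n).
Proof.
move=> m /(_ m)/eqP; rewrite coefsumX samekey_refl.
exact/negP/oner_neq0.
Qed.

Lemma toric_binomial m s : samekey m s -> toric ('X_[m] - 'X_[s] : pring R n).
Proof.
move=> ms m0; rewrite coefsumB !coefsumX.
suff -> : samekey m m0 = samekey s m0 by rewrite subrr.
apply/idP/idP; last exact: samekey_trans.
by apply: samekey_trans; rewrite samekey_sym.
Qed.

Lemma mcoeff_init S f m : (init_part S f)@_m =
  if all (fun m' => grad S m <= grad S m') (msupp f) then f@_m else 0.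
Proof.
exact: (mcoeff_restrict (fun m => all _ (msupp f))).
Qed.

Lemma ex_min_grad S (r : seq (pmonom n)) : r != [::] ->
  exists2 m, m \in r & all (fun m' => grad S m <= grad S m') r.
Proof.
elim: r => // x [_ _|y r /(_ isT)[m mr minm] _].
  by exists x; rewrite ?mem_head //= lexx.
have [xm|mx] := leP (grad S x) (grad S m).
  exists x; first exact: mem_head.
  apply/allP=> z; rewrite inE => /orP[/eqP->//|/(allP minm)]; exact: le_trans.
exists m; first by rewrite inE mr orbT.
apply/allP=> z; rewrite inE => /orP[/eqP->|/(allP minm)//]; exact: ltW.
Qed.

Lemma init_part_eq0 S f : init_part S f = 0 -> f = 0.
Proof.
move=> i0; apply/eqP; rewrite -msupp_eq0; apply: contraT => /(ex_min_grad S)[m mf minm].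
have := mcoeff_init S f m; rewrite i0 mcoeff0 minm => /esym/eqP.
by rewrite mcoeff_eq0 mf.
Qed.

Lemma coefsum_standard q t : {in msupp q, forall s, standard s} -> standard t ->
  coefsum (fun m => (samekey m t)%:R) q = q@_t.
Proof.
move=> sq st; have key0 s : s \in msupp q -> s != t -> samekey s t = false.
  move=> sq' sNt; apply/negP => /andP[/eqP ed /eqP et].
  by move/eqP: sNt; apply; apply: standard_key_inj => //; exact: sq.
rewrite /coefsum; have [tq|tq] := boolP (t \in msupp q).
  rewrite (bigD1_seq t) ?msupp_uniq //= samekey_refl mulr1.
  by rewrite big_seq_cond big1 ?addr0 // => s /andP[/key0 h /h->]; rewrite mulr0.
rewrite (memN_msupp_eq0 tq) big_seq big1 // => s sq'.
by rewrite key0 ?mulr0 //; apply: contraNneq tq => <-.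
Qed.

(** Distinct standard monomials have distinct degrees, so each coefficient sum
    has a single term. *)
Lemma toric_standard q : {in msupp q, forall s, standard s} -> toric q -> q = 0.
Proof.
move=> sq tq; apply/mpolyP=> t; rewrite mcoeff0.
have [tq'|/memN_msupp_eq0//] := boolP (t \in msupp q).
by rewrite -(coefsum_standard sq (sq t tq')) tq.
Qed.

(** The lift of the binomial X^m - X^s to the ideal is X^m - h for h given by
    straightening. Its initial part is toric, so it is not a combination of
    standard monomials alone; it involves X^m, and the coefficient sums leave
    room for one standard monomial only. *)
Lemma init_straightening a m : strictK a -> exists s,
  [/\ standard s, samekey m s & s = m \/
    exists2 f : pring R n, pideal f & init_part (sigma a) f = 'X_[m] - 'X_[s]].
Proof.
move=> sa; have [h sh If] := straightening R m.
have [mh|mh] := boolP (m \in msupp h).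
  by exists m; split; [exact: sh|exact: samekey_refl|left].
set f := _ - h in If; set p := init_part (sigma a) f.
have tp : toric p by exact: init_part_toric.
have fm : f@_m = 1 by rewrite mcoeffB mcoeffX eqxx (memN_msupp_eq0 mh) subr0.
(* The standard part of the initial part. *)
pose q := p - p@_m *: 'X_[m].
have sq : {in msupp q, forall s, standard s}.
  move=> s; rewrite mcoeff_msupp mcoeffB mcoeffZ mcoeffX; have [<-|ms] := eqVneq m s.
    by rewrite mulr1 subrr eqxx.
  rewrite mulr0 subr0 mcoeff_init; case: ifP => _; last by rewrite eqxx.
  rewrite mcoeffB mcoeffX (negPf ms) sub0r oppr_eq0 => hs.
  by apply: sh; rewrite mcoeff_msupp.
have pm : p@_m = 1.
  rewrite mcoeff_init; case: ifP => // nmin.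
  have qp : q = p by rewrite /q mcoeff_init nmin scale0r subr0.
  have /init_part_eq0 f0 : p = 0 by apply: toric_standard => //; rewrite -qp.
  by move: fm; rewrite f0 mcoeff0 => /esym/eqP; rewrite oner_eq0.
have ep : p = 'X_[m] + q by rewrite /q pm scale1r addrC subrK.
(* The coefficient sum of p at the degrees of t has the two terms X^m, X^t. *)
have qt t : standard t -> q@_t = - (samekey m t)%:R.
  move=> st; have := tp t; rewrite ep coefsumD coefsumX coefsum_standard //.
  by move/eqP; rewrite addrC addr_eq0 => /eqP.
have [s sq' sm] : exists2 s, s \in msupp q & samekey s m.
  suff /hasP[s] : has (fun s : pmonom n => samekey s m) (msupp q) by exists s.
  apply: contraT => /hasPn none.
  have /eqP := tp m; rewrite ep coefsumD coefsumX samekey_refl /coefsum big_seq big1.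
    by rewrite addr0 oner_eq0.
  by move=> t /none/negPf->; rewrite mulr0.
exists s; split; [exact: sq|by rewrite samekey_sym|right].
exists f => //; rewrite -/p ep; congr (_ + _); apply/mpolyP=> t.
rewrite mcoeffN mcoeffX; have [<-|sNt] := eqVneq s t.
  by rewrite qt; [rewrite samekey_sym sm|exact: sq].
have [tq|/memN_msupp_eq0->] := boolP (t \in msupp q); last by rewrite oppr0.
rewrite qt; last exact: sq.
case: (boolP (samekey m t)) => // /(samekey_trans sm)/andP[/eqP ed /eqP et].
by move/eqP: sNt; case; apply: standard_key_inj => //; exact: sq.
Qed.

Lemma init_ideal_lin S c p q : init_ideal S p -> init_ideal S q -> init_ideal S (c *: p + q).
Proof.
move=> [r1 h1 ->] [r2 h2 ->]; exists ([seq (c * x.1, x.2) | x <- r1] ++ r2).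
  by move=> x; rewrite mem_cat => /orP[/mapP[y /h1 hy ->]|/h2].
rewrite big_cat /= big_map scaler_sumr; congr (_ + _).
by apply: eq_bigr => x _; rewrite scalerA.
Qed.

Lemma init_ideal0 S : init_ideal S 0.
Proof. by exists [::]; rewrite ?big_nil. Qed.

Lemma init_ideal_init S f : pideal f -> init_ideal S (init_part S f).
Proof.
have [->|f0] := eqVneq f 0.
  rewrite /init_part msupp0 big_nil; move=> _; exact: init_ideal0.
by move=> If; exists [:: (1, f)]; rewrite ?big_seq1 ?scale1r // => x; rewrite inE => /eqP->.
Qed.

(** Modulo the initial ideal, every polynomial is a combination of standard
    monomials, and a toric one is then 0. *)
Theorem init_ideal_sigma a : strictK a -> init_ideal (sigma a) = @toric R n.
Proof.
move=> sa.
have sub p : init_ideal (sigma a) p -> toric p.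
  move=> [r h ->]; rewrite big_seq; elim/big_ind: _.
  - exact: toric0.
  - by move=> x y tx ty; rewrite -[x]scale1r; exact: toric_lin.
  move=> x /h[Ix _]; rewrite -[_ *: _]addr0; apply: toric_lin; last exact: toric0.
  exact: init_part_toric.
have binom m : exists2 s, standard s & init_ideal (sigma a) ('X_[m] - 'X_[s]).
  have [s [ss _ ms]] := init_straightening m sa; exists s => //.
  case: ms => [->|[f If <-]]; first by rewrite subrr; exact: init_ideal0.
  exact: init_ideal_init.
have red p : exists2 q, {in msupp q, forall s, standard s} & init_ideal (sigma a) (p - q).
  rewrite (mpolyE p); elim: (msupp p) => [|m r [q sq Iq]].
    by exists 0; rewrite ?msupp0 // big_nil subrr; exact: init_ideal0.
  have [s ss Is] := binom m; exists (p@_m *: 'X_[s] + q).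
    by move=> t /msuppD_le; rewrite mem_cat => /orP[/msuppZ_le|/sq//]; rewrite msuppX inE => /eqP->.
  rewrite big_cons opprD addrACA -scalerBr; exact: init_ideal_lin.
apply/seteqP; split => [p|p tp]; first exact: sub.
have [q sq Iq] := red p.
suff q0 : q = 0 by rewrite q0 subr0 in Iq.
apply: toric_standard => //; have := toric_lin (-1) (sub _ Iq) tp.
by rewrite scaleN1r opprB subrK.
Qed.

(** Initial parts are homogeneous for grad^S, so the initial ideal contains the
    homogeneous components of its elements. *)
Lemma init_ideal_component S (w : R) p : init_ideal S p ->
  init_ideal S (\sum_(m <- msupp p | grad S m == w) p@_m *: 'X_[m]).
Proof.
move=> [r h ->].
pose b (x : R[i] * pring R n) := has (fun m => grad S m == w) (msupp (init_part S x.2)).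
exists [seq x <- r | b x]; first by move=> x; rewrite mem_filter => /andP[_ /h].
rewrite big_filter; apply/mpolyP=> m.
rewrite (mcoeff_restrict (fun m => grad S m == w)).
rewrite [in RHS]raddf_sum /=; case: eqP => [mw|/eqP mw].
  rewrite raddf_sum /= [RHS]big_mkcond /=; apply: eq_bigr => x _.
  case: ifP => // /negbT/hasPn nb; rewrite mcoeffZ memN_msupp_eq0 ?mulr0 //.
  by apply/negP => /nb; rewrite mw eqxx.
rewrite big1 // => x /hasP[m' + /eqP m'w]; rewrite mcoeff_msupp !mcoeffZ !mcoeff_init.
case: ifP => [/allP min' fm'|_]; last by rewrite eqxx.
case: ifP => [/allP min|_]; last by rewrite mulr0.
have [mf|/memN_msupp_eq0->] := boolP (m \in msupp x.2); last by rewrite mulr0.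
case/eqP: mw; apply/eqP; rewrite -m'w eq_le min' // andbT.
by apply: min; rewrite mcoeff_msupp.
Qed.

(** Otherwise a homogeneous component of a binomial in the toric ideal would be
    a monomial. *)
Lemma toric_grad_const S : init_ideal S = @toric R n ->
  forall m s, samekey m s -> grad S m = grad S s.
Proof.
move=> IT m s ms; apply/eqP; apply: contraT => gms.
have := toric_binomial ms; rewrite -IT => /(init_ideal_component (grad S m)).
rewrite IT.
have mNs : m != s by apply: contraNneq gms => ->.
suff -> : \sum_(m' <- msupp ('X_[m] - 'X_[s] : pring R n) | grad S m' == grad S m)
    ('X_[m] - 'X_[s] : pring R n)@_m' *: 'X_[m'] = 'X_[m] by move/toric_monomial_free.
apply/mpolyP=> t; rewrite (mcoeff_restrict (fun m' => grad S m' == grad S m)).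
rewrite mcoeffB !mcoeffX; have [<-|mt] := eqVneq m t.
  by rewrite eqxx eq_sym (negPf mNs) subr0.
have [<-|_] := eqVneq s t; last by rewrite subr0 if_same.
by rewrite eq_sym (negPf gms).
Qed.

End InitialIdealOfInterior.

(** * Recovering a from sigma(a) *)

Section InitialSegmentSets.
Variable n : nat.
Implicit Types (t : seq nat) (l j : nat).

Lemma elts_seq (A : {set 'I_n}) t : sorted ltn t -> all (gtn n) t ->
  (forall x : 'I_n, (x \in A) = ((x : nat) \in t)) -> [seq val i | i <- enum A] = t.
Proof.
move=> st tn At; apply: (irr_sorted_eq ltn_trans ltnn (sorted_elts A) st) => x.
apply/mapP/idP => [[y + ->]|xt]; first by rewrite mem_enum At.
have xn : (x < n)%N by exact: (allP tn).
by exists (Ordinal xn); rewrite // mem_enum At.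
Qed.

(** These sets read off a: their coordinates of sigma(a) are single entries of a
    ([sigma_iset]). *)
Definition iset l j : {set 'I_n} := [set x : 'I_n | (x < l)%N || (x == j :> nat)]%SET.

Lemma elts_iset l j : (l <= j < n)%N ->
  [seq val i | i <- enum (iset l j)] = rcons (iota 0 l) j.
Proof.
case/andP=> lj jn; apply: elts_seq => [||x].
- rewrite (sorted_pairwise ltn_trans) pairwise_rcons -(sorted_pairwise ltn_trans).
  rewrite iota_ltn_sorted andbT; apply/allP => x; rewrite mem_iota add0n => /andP[_ xl].
  exact: leq_trans xl lj.
- rewrite all_rcons /= jn; apply/allP => x; rewrite mem_iota /= add0n => xl.
  exact: leq_trans xl (leq_trans lj (ltnW jn)).
by rewrite inE mem_rcons inE mem_iota add0n orbC.
Qed.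

Lemma elt_iset l j r : (l <= j < n)%N ->
  elt (iset l j) r = if (r < l)%N then r else if r == l then j else n.
Proof.
move=> lj; rewrite /elt elts_iset // nth_rcons size_iota.
by case: ifP => // rl; rewrite nth_iota.
Qed.

Lemma card_iset l j : (l <= j < n)%N -> #|iset l j| = l.+1.
Proof. by move=> lj; rewrite -size_elts elts_iset // size_rcons size_iota. Qed.

Lemma iset_diag (A : pindex n) l : val A = iset l l ->
  val A = [set i : 'I_n | (i < #|val A|)%N]%SET.
Proof.
move=> eA; have /andP[_ An] := valP A.
have [ln|nl] := ltnP l n; last first.
  have eT : val A = [set: 'I_n]%SET.
    by apply/setP=> x; rewrite eA !inE (leq_trans (ltn_ord x) nl).
  by move: An; rewrite eT cardsT card_ord ltnn.
rewrite {1}eA eA card_iset ?leqnn //; apply/setP=> x; rewrite !inE.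
by rewrite [RHS]ltnS [RHS]leq_eqVlt orbC.
Qed.

(** A0 is a placeholder for sets that index no variable. *)
Definition pindex_iset (A0 : pindex n) l j : pindex n := insubd A0 (iset l j).

Lemma val_pindex_iset A0 l j : (l <= j < n)%N -> (l.+1 < n)%N -> val (pindex_iset A0 l j) = iset l j.
Proof. by move=> lj ln; rewrite /pindex_iset insubdK // unfold_in card_iset. Qed.

End InitialSegmentSets.

Section SigmaEntries.
Variables (R : realType) (n : nat).
Implicit Types (a : Theta R n) (A : pindex n) (S : Xi R n) (m : pmonom n).

Lemma entryE a (p : pos n) : entry a (val p).1 (val p).2 = a p.
Proof.
by rewrite /entry (big_pred1 p).
Qed.

Lemma entry_out a i j : ~~ (i < j < n)%N -> entry a i j = 0.
Proof.
move=> ij; rewrite /entry big_pred0 // => p; apply/negP=> /andP[/eqP e1 /eqP e2].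
by case/negP: ij; rewrite -e1 -e2 (valP p) ltn_ord.
Qed.

Lemma entry_diag a i : entry a i i = 0.
Proof. by rewrite entry_out // ltnn. Qed.

Definition mkpos i j (ij : (i < j)%N) (jn : (j < n)%N) : pos n :=
  exist (fun p : 'I_n * 'I_n => is_true (p.1 < p.2)%N)
    (Ordinal (ltn_trans ij jn), Ordinal jn) ij.

Lemma entry_mkpos a i j (ij : (i < j)%N) (jn : (j < n)%N) : entry a i j = a (mkpos ij jn).
Proof. exact: (entryE a (mkpos ij jn)). Qed.

Lemma gradD S m m' : grad S (m + m')%MM = grad S m + grad S m'.
Proof. by rewrite -big_split; apply: eq_bigr => A _; rewrite mnmDE mulrnDr. Qed.

Lemma grad_0 S : grad S 0%MM = 0.
Proof. by rewrite /grad big1 // => p _; rewrite mnm0E. Qed.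

Lemma grad1 S A : grad S U_(enum_rank A)%MM = S A.
Proof.
rewrite /grad (bigD1 A) //= -/(mult _ _) mult1 eqxx mulr1n big1 ?addr0 // => B BA.
by rewrite -/(mult _ _) mult1 eq_sym (negPf BA).
Qed.

Lemma sigmaE a A : sigma a A = \sum_(r < #|val A|) entry a r (elt (val A) r).
Proof.
rewrite -grad1 grad_sigma Tdeg1E (big_morph _ (zwtD a) (zwt0 a)).
by apply: eq_bigr => r _; rewrite zwt_umon.
Qed.

Lemma sigma_iset a A l j : (l <= j < n)%N -> val A = iset n l j -> sigma a A = entry a l j.
Proof.
move=> lj eA; rewrite sigmaE eA card_iset // big_ord_recr /= elt_iset // ltnn eqxx.
by rewrite big1 ?add0r // => r _; rewrite elt_iset // ltn_ord entry_diag.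
Qed.

Lemma sigma_Xi0 a : Xi0 (sigma a).
Proof.
move=> A eA; rewrite sigmaE big1 // => r _; rewrite (_ : elt _ _ = r) ?entry_diag //.
rewrite /elt (elts_seq (t := iota 0 #|val A|)) ?nth_iota // ?iota_ltn_sorted //.
  apply/allP=> x; rewrite mem_iota add0n => /andP[_] /leq_trans; apply.
  exact: card_set_ord_le.
by move=> x; rewrite {1}eA inE mem_iota add0n.
Qed.

(** A left inverse of sigma ([unsigmaK]). *)
Definition unsigma (A0 : pindex n) S : Theta R n :=
  [ffun p : pos n => S (pindex_iset A0 (val p).1 (val p).2)].

Lemma unsigmaK A0 a : unsigma A0 (sigma a) = a.
Proof.
apply/ffunP=> p; rewrite ffunE -[RHS]entryE.
have pn : ((val p).1 < (val p).2 < n)%N by rewrite (valP p) ltn_ord.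
have /andP[lj jn] := pn.
have ljn : ((val p).1 <= (val p).2 < n)%N by rewrite ltnW.
by apply: sigma_iset; rewrite ?val_pindex_iset // (leq_ltn_trans lj).
Qed.

Lemma entry_unsigma A0 S l j : Xi0 S -> (l <= j < n)%N -> (l.+1 < n)%N ->
  entry (unsigma A0 S) l j = S (pindex_iset A0 l j).
Proof.
move=> S0 ljn ln; have /andP[lj jn] := ljn.
move: lj; rewrite leq_eqVlt => /orP[/eqP e|lj].
  by rewrite -e entry_diag; apply/esym/S0/(@iset_diag _ _ l); rewrite val_pindex_iset // leqnn ltnW.
by rewrite (entry_mkpos _ lj jn) ffunE.
Qed.

(** Write i_1 < ... < i_k for the elements of A. The monomials
    X_A * prod_(l < k) X_(1, ..., l) and prod_(l <= k) X_(1, ..., l - 1, i_l) have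
    the same degrees, and S vanishes on the variables X_(1, ..., l). *)
Lemma grad_const_sigma A0 S : Xi0 S -> (forall m s, samekey m s -> grad S m = grad S s) ->
  S = sigma (unsigma A0 S).
Proof.
move=> S0 gS; apply/ffunP=> A; rewrite sigmaE.
have /andP[A_gt0 An] := valP A.
have [k kA] : exists k, #|val A| = k.+1 by exists #|val A|.-1; rewrite prednK.
have ltk (r : 'I_k) : (r.+1 < n)%N by apply: leq_ltn_trans An; rewrite kA ltnS ltnW.
have elt_r r : (r < #|val A|)%N -> (r <= elt (val A) r < n)%N && (r.+1 < n)%N.
  move=> rA; have rn : (r.+1 < n)%N by exact: leq_ltn_trans rA An.
  by rewrite rn elt_lt // elt_id_le // ltnW // ltnW.
pose U (B : pindex n) : pmonom n := U_(enum_rank B)%MM.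
(* The set iset r r is {0, ..., r}, on which S vanishes. *)
pose m1 := (U A + \sum_(r < k) U (pindex_iset A0 r r))%MM.
pose m2 := (\sum_(r < #|val A|) U (pindex_iset A0 r (elt (val A) r)))%MM.
have gradS (N : nat) (F : 'I_N -> pindex n) :
    grad S (\sum_(r < N) U (F r))%MM = \sum_(r < N) S (F r).
  by rewrite (big_morph _ (gradD S) (grad_0 S)); apply: eq_bigr => r _; rewrite grad1.
have : grad S m1 = grad S m2.
  apply: gS; apply/andP; split; apply/eqP.
    have mdeg0 : multideg (0%MM : pmonom n) = [ffun _ => 0%N].
      by apply/ffunP=> c; rewrite !ffunE big1 // => B _; rewrite mnm0E.
    have mdegS N (F : 'I_N -> pindex n) (c : 'I_n) :
        multideg (\sum_(r < N) U (F r))%MM c = (\sum_(r < N) (#|val (F r)| == c))%N.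
      rewrite (big_morph (fun m => multideg m c) (id1 := 0%N) (op1 := addn)).
      - by apply: eq_bigr => r _; rewrite multideg1 ffunE.
      - by move=> x y; rewrite multidegD ffunE.
      by rewrite mdeg0 ffunE.
    apply/ffunP=> c; rewrite multidegD ffunE multideg1 ffunE !mdegS.
    transitivity (\sum_(r < #|val A|) (r.+1 == c))%N; last first.
      apply: eq_bigr => r _; have /andP[h1 h2] := elt_r r (ltn_ord r).
      by rewrite val_pindex_iset // card_iset.
    rewrite kA big_ord_recr addnC /=; congr (_ + _)%N; apply: eq_bigr => r _.
    by rewrite val_pindex_iset ?card_iset // leqnn ltnW.
  apply/mnmP=> p; set l := (val (enum_val p)).1; set j := (val (enum_val p)).2.
  have lj : (l < j)%N := valP (enum_val p).
  have tS (N : nat) (F : 'I_N -> pindex n) :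
      Tdeg (\sum_(r < N) U (F r))%MM p = (\sum_(r < N) (elt (val (F r)) l == j))%N.
    rewrite (big_morph _ (@TdegD n) (Tdeg0 n)) mnm_sumE.
    by apply: eq_bigr => r _; rewrite Tdeg1.
  rewrite TdegD mnmDE Tdeg1 !tS -/l -/j big1 ?addn0; last first.
    move=> r _; rewrite val_pindex_iset ?leqnn ?(ltnW (ltk r)) // elt_iset ?leqnn ?(ltnW (ltk r)) //.
    have jn := ltn_ord j.
    case: ltnP => rl; first by rewrite (ltn_eqF lj).
    by have [<-|_] := eqVneq (l : nat) r; rewrite ?(ltn_eqF lj) ?(gtn_eqF jn).
  transitivity (\sum_(r < #|val A|) ((r == l :> nat) && (elt (val A) l == j)))%N; last first.
    apply: eq_bigr => r _; have /andP[h1 h2] := elt_r r (ltn_ord r).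
    rewrite val_pindex_iset // elt_iset //; have jn := ltn_ord j.
    case: (ltngtP r l) => [rl|lr|rl] /=; last by rewrite rl.
    - by rewrite (gtn_eqF jn).
    by rewrite (ltn_eqF lj).
  have [lA|lA] := ltnP l #|val A|.
    rewrite (bigD1 (Ordinal lA)) //= eqxx big1 ?addn0 // => r.
    by rewrite -val_eqE /= => /negPf->.
  rewrite (elt_default lA) (gtn_eqF (ltn_ord j)) big1 // => r _.
  by rewrite andbF.
rewrite gradD grad1 !gradS [X in _ + X]big1 ?addr0 => [->|r _]; last first.
  by apply/S0/(@iset_diag _ _ r); rewrite val_pindex_iset // leqnn ltnW.
apply: eq_bigr => r _; have /andP[h1 h2] := elt_r r (ltn_ord r).
by rewrite entry_unsigma.
Qed.

End SigmaEntries.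

(** * Three-term relations *)

Section ThreeTerm.
Variables (R : realType) (n : nat).
Implicit Types (g : 'M[R[i]]_n).

(** Expand, along its first column, the determinant of the rows u with column c
    repeated in front. *)
Lemma exchange_coordinate k (kn : (k <= n)%N) g (u : 'I_k.+1 -> 'I_n) (c : 'I_k) :
  \sum_(r < k.+1) (-1) ^+ r * g (u r) (widen_ord kn c) * tminor kn g (u \o lift r) = 0.
Proof.
pose M : 'M_k.+1 := \matrix_(r, j) g (u r) (widen_ord kn (odflt c (unlift ord0 j))).
have : \det M = 0.
  rewrite -det_tr; apply: (@determinant_alternate _ _ _ ord0 (lift ord0 c)) => // r.
  by rewrite !mxE unlift_none liftK.
rewrite (expand_det_col M ord0) => e; rewrite -[RHS]e; apply: eq_bigr => r _.
rewrite /cofactor !mxE unlift_none addn0 mulrCA mulrA; congr (_ * \det _).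
by apply/matrixP=> s j; rewrite !mxE liftK.
Qed.

Definition snoc k (t : 'I_k -> 'I_n) (x : 'I_n) (r : 'I_k.+1) : 'I_n :=
  if unlift ord_max r is Some r' then t r' else x.

Lemma tminor_snoc k (kn : (k.+1 <= n)%N) g (t : 'I_k -> 'I_n) :
  exists w : 'I_k.+1 -> R[i], forall x,
    tminor kn g (snoc t x) = \sum_c g x (widen_ord kn c) * w c.
Proof.
exists (fun c : 'I_k.+1 => (-1) ^+ (k + c) *
  \det (\matrix_(r < k, j < k) g (t r) (widen_ord kn (lift c j)))) => x.
rewrite /tminor (expand_det_row _ ord_max); apply: eq_bigr => c _.
rewrite /cofactor !mxE /snoc unlift_none; congr (_ * (_ * \det _)).
by apply/matrixP=> r j; rewrite !mxE liftK.
Qed.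

(** As a function of its last row, a smaller minor is a linear combination of
    coordinates, to each of which [exchange_coordinate] applies. *)
Lemma plucker_exchange k k' (kn : (k <= n)%N) (kn' : (k'.+1 <= n)%N) g
    (u : 'I_k.+1 -> 'I_n) (t : 'I_k' -> 'I_n) : (k' < k)%N ->
  \sum_(r < k.+1) (-1) ^+ r * tminor kn' g (snoc t (u r)) * tminor kn g (u \o lift r) = 0.
Proof.
move=> k'k; have [w wE] := tminor_snoc kn' g t.
under eq_bigr => r _ do rewrite wE -mulrA mulr_suml mulr_sumr.
rewrite exchange_big big1 // => c _ /=.
have e := exchange_coordinate kn g u (widen_ord k'k c).
apply: (etrans _ (etrans (congr1 ( *%R (w c)) e) (mulr0 _))).
rewrite mulr_sumr; apply: eq_bigr => r _.
have -> : widen_ord kn' c = widen_ord kn (widen_ord k'k c) by apply: val_inj.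
by ring.
Qed.

Definition jset (i b c : nat) : {set 'I_n} :=
  [set x : 'I_n | [|| (x < i)%N, x == b :> nat | x == c :> nat]]%SET.

Lemma elts_jset i b c : (i <= b)%N -> (b < c < n)%N ->
  [seq val x | x <- enum (jset i b c)] = iota 0 i ++ [:: b; c].
Proof.
move=> ib /andP[bc cn]; apply: elts_seq => [||x].
- rewrite (sorted_pairwise ltn_trans) pairwise_cat -(sorted_pairwise ltn_trans).
  rewrite iota_ltn_sorted /= !andbT bc andbT.
  apply/allrelP=> x y; rewrite mem_iota !inE add0n => /andP[_ xi] /orP[]/eqP->; lia.
- rewrite all_cat /= cn (ltn_trans bc cn) !andbT; apply/allP => x.
  by rewrite mem_iota /= add0n => xl; lia.
by rewrite inE mem_cat !inE mem_iota add0n.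
Qed.

Lemma elt_jset i b c r : (i <= b)%N -> (b < c < n)%N ->
  elt (jset i b c) r =
    if (r < i)%N then r else if r == i then b else if r == i.+1 then c else n.
Proof.
move=> ib bcn; rewrite /elt elts_jset // nth_cat size_iota.
case: ltnP => ri; first by rewrite nth_iota.
case: eqP => [->|rNi]; first by rewrite subnn.
case: eqP => [->|rNi']; first by rewrite subSnn.
by rewrite nth_default //=; lia.
Qed.

Lemma card_jset i b c : (i <= b)%N -> (b < c < n)%N -> #|jset i b c| = i.+2.
Proof. by move=> ib bcn; rewrite -size_elts elts_jset // size_cat size_iota addn2. Qed.

(** [plucker_exchange] for the rows 0, ..., i, b, c: the minors on the rows
    0, ..., i - 1, x vanish for x < i, which leaves three terms. *)
Lemma three_term_relation g (A0 : pindex n) i (b c : 'I_n) (bc : pindex n) :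
  (i < b)%N -> (b < c)%N -> val bc = jset i b c ->
  pcoord g (pindex_iset A0 i i) * pcoord g bc
  - pcoord g (pindex_iset A0 i b) * pcoord g (pindex_iset A0 i.+1 c)
  + pcoord g (pindex_iset A0 i c) * pcoord g (pindex_iset A0 i.+1 b) = 0.
Proof.
move=> ib bltc ebc; have cn := ltn_ord c; have bn := ltn_ord b.
have k3n : (i.+3 <= n)%N by lia.
have k2n : (i.+2 <= n)%N by lia.
have k1n : (i.+1 <= n)%N by lia.
have in_ : (i <= n)%N by lia.
pose u (r : 'I_i.+3) : 'I_n :=
  if (r <= i)%N then widen_ord k3n r else if r == i.+1 :> nat then b else c.
pose t (r : 'I_i) : 'I_n := widen_ord in_ r.
have uE (r : 'I_i.+3) : u r = (if (r <= i)%N then r : nat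
    else if r == i.+1 :> nat then b : nat else c) :> nat.
  by rewrite /u; case: ifP => // _; case: ifP.
have snocE (x : 'I_n) : (i <= x)%N -> tminor k1n g (snoc t x) = pcoord g (pindex_iset A0 i x).
  move=> ix; have ixn : (i <= x < n)%N by rewrite ix ltn_ord.
  apply: tminor_mono => [|r]; rewrite val_pindex_iset ?card_iset ?elt_iset //.
  rewrite /snoc; case: unliftP => [r' ->|->]; last by rewrite ltnn eqxx.
  by rewrite lift_max ltn_ord.
have snoc0 (x : 'I_n) : (x < i)%N -> tminor k1n g (snoc t x) = 0.
  move=> xi; apply: tminor_noninj; apply/injectivePn.
  exists ord_max, (lift ord_max (Ordinal xi)); first exact: neq_lift.
  by rewrite /snoc unlift_none liftK; apply: val_inj.
have liftE (r0 : 'I_i.+3) (A : pindex n) : #|val A| = i.+2 ->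
    (forall r : 'I_i.+2, elt (val A) r = u (lift r0 r)) ->
    tminor k2n g (u \o lift r0) = pcoord g A.
  by move=> Ai e; apply: tminor_mono.
have := plucker_exchange k2n k1n g u t (leqnSn i.+1).
rewrite !big_ord_recr /= big1 ?add0r; last first.
  move=> r _; rewrite snoc0 ?mulr0 ?mul0r // uE /= ifT; first exact: ltn_ord.
  exact: ltnW (ltn_ord r).
rewrite !snocE ?uE /=; try by (do ?case: ifP => //=; lia).
have ibn : (i < b < n)%N by rewrite ib.
have icn : (i < c < n)%N by rewrite cn (ltn_trans ib).
have bcn : (b < c < n)%N by rewrite bltc.
rewrite (liftE _ bc); last 2 first.
- by rewrite ebc card_jset // ltnW.
- move=> r; rewrite ebc elt_jset ?(ltnW ib) // uE /= /bump.
  by have := ltn_ord r; do ?case: ifP => //; lia.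
rewrite (liftE _ (pindex_iset A0 i.+1 c)); last 2 first.
- by rewrite val_pindex_iset // card_iset.
- move=> r; rewrite val_pindex_iset // elt_iset // uE /= /bump.
  by have := ltn_ord r; do ?case: ifP => //; lia.
rewrite (liftE _ (pindex_iset A0 i.+1 b)); last 2 first.
- by rewrite val_pindex_iset // card_iset.
- move=> r; rewrite val_pindex_iset // elt_iset // uE /= /bump.
  by have := ltn_ord r; do ?case: ifP => //; lia.
rewrite leqnn ltnn eqxx ltnNge leqnSn /= gtn_eqF //.
have s0 : (-1) ^+ i != 0 :> R[i] by rewrite signr_eq0.
move=> e; apply: (mulfI s0); rewrite mulr0; apply: etrans e.
by rewrite !exprS; ring.
Qed.

End ThreeTerm.

Section StrictnessFromInitialIdeal.
Variables (R : realType) (n : nat).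
Implicit Types (a : Theta R n).

(** The first two terms of a three-term relation have the same T-degree, hence
    the same grade, namely the left-hand side of an inequality defining K. The
    grade of the third term is its right-hand side, and the T-degree of the
    third term is different. If the inequality failed to be strict, the third
    term would belong to the initial part, whose coefficient sum at that degree
    would be 1. *)
Lemma strictK_of_init_ideal a : init_ideal (sigma a) = @toric R n -> strictK a.
Proof.
move=> IT i j ij j1n.
have jn : (j < n)%N := ltn_trans (ltnSn j) j1n.
pose b : 'I_n := Ordinal jn; pose c : 'I_n := Ordinal j1n.
have bcn : (b < c < n)%N by rewrite /= ltnSn.
have ib : (i <= b)%N by exact: ltnW.
have i2n : (i.+2 < n)%N := leq_ltn_trans (ij : (i.+2 <= j.+1)%N) j1n.
have cjset : (0 < #|jset n i b c| < n)%N by rewrite card_jset.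
pose bc : pindex n := pindex_of cjset.
pose A := pindex_iset bc i i; pose B := pindex_iset bc i b; pose B' := pindex_iset bc i.+1 c.
pose C := pindex_iset bc i c; pose C' := pindex_iset bc i.+1 b.
have vA : val A = iset n i i by rewrite val_pindex_iset //; lia.
have vB : val B = iset n i b by rewrite val_pindex_iset //=; lia.
have vB' : val B' = iset n i.+1 c by rewrite val_pindex_iset //=; lia.
have vC : val C = iset n i c by rewrite val_pindex_iset //=; lia.
have vC' : val C' = iset n i.+1 b by rewrite val_pindex_iset //=; lia.
pose m1 : pmonom n := (U_(enum_rank A) + U_(enum_rank bc))%MM.
pose m2 : pmonom n := (U_(enum_rank B) + U_(enum_rank B'))%MM.
pose m3 : pmonom n := (U_(enum_rank C) + U_(enum_rank C'))%MM.
(* Only the third monomial has z_(i,j+1) in its image. *)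
pose p := mkpos (ltn_trans ij (ltnSn j)) j1n.
have tp (D D' : pindex n) : Tdeg (U_(enum_rank D) + U_(enum_rank D'))%MM (enum_rank p) =
    ((elt (val D) i == c) + (elt (val D') i == c))%N.
  by rewrite TdegD mnmDE !Tdeg1 enum_rankK.
have row_iset (x : nat) : (i <= x < n)%N -> elt (iset n i x) i = x.
  by move=> ix; rewrite elt_iset // ltnn eqxx.
have row_isetS (x : nat) : (i.+1 <= x < n)%N -> elt (iset n i.+1 x) i = i.
  by move=> ix; rewrite elt_iset // ltnSn.
have row_bc : elt (jset n i b c) i = j by rewrite elt_jset // ltnn eqxx.
have key13 : samekey m1 m3 = false.
  apply/negP=> /andP[_ /eqP/(congr1 (fun t : 'X_{1.._} => t (enum_rank p)))].
  rewrite !tp vA vC vC' row_bc !row_iset ?row_isetS /=; lia.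
have key23 : samekey m2 m3 = false.
  apply/negP=> /andP[_ /eqP/(congr1 (fun t : 'X_{1.._} => t (enum_rank p)))].
  rewrite !tp vB vB' vC vC' !row_iset ?row_isetS /=; lia.
have m13 : m1 != m3 by apply: contraFneq key13 => ->; exact: samekey_refl.
have m23 : m2 != m3 by apply: contraFneq key23 => ->; exact: samekey_refl.
pose f : pring R n := 'X_[m1] - 'X_[m2] + 'X_[m3].
have suppf m : m \in msupp f -> [\/ m = m1, m = m2 | m = m3].
  move/msuppD_le; rewrite mem_cat => /orP[/msuppB_le|]; rewrite ?mem_cat !msuppX !inE.
    by case/orP=> /eqP->; [constructor 1|constructor 2].
  by move/eqP->; constructor 3.
have If : pideal f.
  apply: (@pideal_multihomog _ _ (multideg m3)) => [m /suppf|g].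
    have dE (D D' : pindex n) : #|val D| = i.+1 -> #|val D'| = i.+2 ->
        multideg (U_(enum_rank D) + U_(enum_rank D'))%MM =
        [ffun k : 'I_n => ((i.+1 == k) + (i.+2 == k))%N].
      by move=> e e'; apply/ffunP=> k; rewrite multidegD !multideg1 !ffunE e e'.
    have ii : (i <= i < n)%N by lia.
    have ic : (i <= c < n)%N by rewrite /=; lia.
    have i1c : (i < c < n)%N by rewrite /=; lia.
    have i1b : (i < b < n)%N by rewrite /=; lia.
    have ibn : (i <= b < n)%N by rewrite /=; lia.
    by case=> ->; rewrite !dE ?vA ?vB ?vB' ?vC ?vC' ?card_iset ?card_jset.
  rewrite mevalD mevalB /m1 /m2 /m3 !mpolyXD !mevalM !meval_var.
  by apply: three_term_relation => //=.
have fm3 : f@_m3 = 1.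
  by rewrite mcoeffD mcoeffB !mcoeffX (negPf m13) (negPf m23) eqxx subrr add0r.
have := init_ideal_init (sigma a) If; rewrite IT => /(_ m3).
rewrite coefsum_init => sum0.
have gE (D D' : pindex n) : grad (sigma a) (U_(enum_rank D) + U_(enum_rank D'))%MM =
    sigma a D + sigma a D' by rewrite gradD !grad1.
have g1 : grad (sigma a) m1 = entry a i j + entry a i.+1 j.+1.
  rewrite gE (sigma_iset _ _ vA) ?entry_diag ?add0r; last by lia.
  rewrite sigmaE /= card_jset // !big_ord_recr /= !elt_jset // ltnn eqxx.
  rewrite big1 ?add0r => [|r _]; last by rewrite elt_jset // ltn_ord entry_diag.
  by rewrite ltnNge leqnSn /= gtn_eqF // eqxx.
have g2 : grad (sigma a) m2 = entry a i j + entry a i.+1 j.+1.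
  by rewrite gE (sigma_iset _ _ vB) ?(sigma_iset _ _ vB') //=; lia.
have g3 : grad (sigma a) m3 = entry a i j.+1 + entry a i.+1 j.
  by rewrite gE (sigma_iset _ _ vC) ?(sigma_iset _ _ vC') //=; lia.
rewrite -g1 -g3 ltNge; apply/negP => le31; move: sum0.
have m3f : m3 \in msupp f by rewrite mcoeff_msupp fm3 oner_eq0.
have min3 : all (fun m' => grad (sigma a) m3 <= grad (sigma a) m') (msupp f).
  by apply/allP => m /suppf[] -> //; rewrite g2 -g1.
rewrite big_mkcond (bigD1_seq m3) ?msupp_uniq //= min3 fm3 samekey_refl mulr1.
rewrite big_seq_cond big1 => [/eqP|m /andP[/suppf mf mNm3]].
  by rewrite addr0 oner_eq0.
case: ifP => // _; case: mf mNm3 => ->; rewrite ?key13 ?key23 ?mulr0 //.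
by rewrite eqxx.
Qed.

End StrictnessFromInitialIdeal.

(** * Rational cones and small perturbations *)

Section RationalCones.
Variables (R : realType) (T : finType).
Implicit Types (K : set {ffun T -> R}) (x y : {ffun T -> R}) (L : {ffun T -> R} -> R).

Definition shift x (e : R) y : {ffun T -> R} := [ffun t => x t + e * y t].

Lemma shiftE x e y t : shift x e y t = x t + e * y t.
Proof. by rewrite ffunE. Qed.

(** The linear functionals with integral coefficients. *)
Definition intfun L := exists c : {ffun T -> int}, forall x, L x = \sum_t (c t)%:~R * x t.

Lemma intfun_ext L L' : L =1 L' -> intfun L -> intfun L'.
Proof. by move=> e [c h]; exists c => x; rewrite -e h. Qed.

Lemma intfun_coord t : intfun (fun x => x t).
Proof.
exists [ffun t' => (t' == t)%:R] => x.
rewrite (bigD1 t) //= ffunE eqxx mul1r big1 ?addr0 // => t' /negPf nt.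
by rewrite ffunE nt mul0r.
Qed.

Lemma intfun0 : intfun (fun=> 0).
Proof. by exists [ffun=> 0] => x; rewrite big1 // => t _; rewrite ffunE mul0r. Qed.

Lemma intfunD L L' : intfun L -> intfun L' -> intfun (fun x => L x + L' x).
Proof.
move=> [c h] [c' h']; exists [ffun t => c t + c' t] => x.
by rewrite h h' -big_split; apply: eq_bigr => t _; rewrite ffunE rmorphD mulrDl.
Qed.

Lemma intfunN L : intfun L -> intfun (fun x => - L x).
Proof.
move=> [c h]; exists [ffun t => - c t] => x.
by rewrite h -sumrN; apply: eq_bigr => t _; rewrite ffunE rmorphN mulNr.
Qed.

Lemma intfun_sum (I : Type) (r : seq I) (P : pred I) (L : I -> {ffun T -> R} -> R) :
  (forall i, intfun (L i)) -> intfun (fun x => \sum_(i <- r | P i) L i x).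
Proof.
move=> h; elim: r => [|i r IH].
  by apply: intfun_ext intfun0 => x; rewrite big_nil.
case Pi: (P i).
  by apply: intfun_ext (intfunD (h i) IH) => x; rewrite big_cons Pi.
by apply: intfun_ext IH => x; rewrite big_cons Pi.
Qed.

Lemma intfun_shift L x e y : intfun L -> L (shift x e y) = L x + e * L y.
Proof.
move=> [c h]; rewrite !h mulr_sumr -big_split; apply: eq_bigr => t _.
by rewrite ffunE mulrDr; congr (_ + _); exact: mulrCA.
Qed.

Lemma intfun_lin L (s : seq (R * {ffun T -> R})) y : intfun L ->
  (forall t, y t = \sum_(e <- s) e.1 * e.2 t) -> L y = \sum_(e <- s) e.1 * L e.2.
Proof.
move=> [c h] ye; rewrite h; under eq_bigr do rewrite ye mulr_sumr.
rewrite exchange_big; apply: eq_bigr => e _; rewrite h mulr_sumr.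
by apply: eq_bigr => t _; exact: mulrCA.
Qed.

Lemma rational_cone_intfun (I : finType) (L : I -> {ffun T -> R} -> R) :
  (forall i, intfun (L i)) -> rational_cone [set x | forall i, 0 <= L i x].
Proof.
move=> /fin_all_exists[c h]; exists [seq c i | i <- enum I].
apply/seteqP; split => x /= hx.
  by move=> _ /mapP[i _ ->]; rewrite -h.
by move=> i; rewrite h; apply: hx; rewrite map_f // mem_enum.
Qed.

Lemma small_perturbation (I : eqType) (r : seq I) (u v : I -> R) :
  exists2 e, 0 < e & forall t, t \in r -> 0 < u t -> 0 < u t + e * v t.
Proof.
suff [e e0 h] : exists2 e, 0 < e & forall t, t \in r -> 0 < u t ->
    forall e', 0 < e' <= e -> 0 < u t + e' * v t.
  by exists e => // t tr ut; apply: h => //; rewrite e0 lexx.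
elim: r => [|t0 r [e e0 h]]; first by exists 1.
have [ut0|ut0] := leP (u t0) 0.
  by exists e => // t; rewrite inE => /orP[/eqP->|]; [rewrite ltNge ut0|exact: h].
have v0 : 0 < 1 + `|v t0| by rewrite ltr_pwDl.
pose e1 := u t0 / (1 + `|v t0|).
have e10 : 0 < e1 by rewrite divr_gt0.
exists (Num.min e e1) => [|t]; first by rewrite lt_min e0.
rewrite inE => /orP[/eqP-> _ e'|tr ut e'] /andP[e'0]; rewrite le_min => /andP[ee ee1]; last first.
  by apply: h => //; rewrite e'0.
have h1 : e' * (1 + `|v t0|) <= u t0 by rewrite -ler_pdivlMr.
have h2 : - (e' * `|v t0|) <= e' * v t0.
  by rewrite -mulrN ler_pM2l // lerNl -normrN ler_norm.
by lra.
Qed.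

Section RationalConeTheory.
Variable K : set {ffun T -> R}.
Hypothesis rK : rational_cone K.

Lemma rational_cone_shift x e y : 0 <= e -> K x -> K y -> K (shift x e y).
Proof.
case: rK => s -> e0 Kx Ky c cs.
rewrite (@intfun_shift (fun x => \sum_t (c t)%:~R * x t)); last by exists c.
by rewrite addr_ge0 ?Kx // mulr_ge0 ?Ky.
Qed.

Lemma rational_cone0 : K [ffun=> 0].
Proof.
by case: rK => s -> c _; rewrite big1 // => t _; rewrite ffunE mulr0.
Qed.

(** A neighbourhood of y in the affine hull of K is mapped to a neighbourhood of
    x + e y by scaling and adding x. Since K contains 0, its affine hull is a
    linear subspace, so it is preserved. *)
Lemma relint_shift x e y : 0 < e -> K x -> relint K y -> relint K (shift x e y).
Proof.
move=> e0 Kx [Ky [eps eps0 h]]; split; first exact: rational_cone_shift (ltW e0) Kx Ky.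
exists (e * eps); first exact: mulr_gt0.
have eN0 : e != 0 by rewrite gt_eqF.
move=> z [s [sK s1 sz]] zx.
pose z' : {ffun T -> R} := [ffun t => (z t - x t) / e].
have -> : z = shift x e z'.
  by apply/ffunP=> t; rewrite !ffunE mulrC divfK // addrC subrK.
apply: (rational_cone_shift (ltW e0) Kx); apply: h => [|t]; last first.
  rewrite ffunE -(ltr_pM2l e0) -{1}(gtr0_norm e0) -normrM mulrBr mulrC divfK //.
  by have := zx t; rewrite ffunE opprD addrA.
(* The summand 0, with coefficient 1, makes the coefficients sum up to 1. *)
exists ([seq (w.1 / e, w.2) | w <- s] ++ [:: (- e^-1, x); (1, [ffun=> 0])]).
split.
- move=> w; rewrite mem_cat !inE => /orP[/mapP[w' /sK Kw' ->]//|].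
  by case/orP => /eqP-> //=; exact: rational_cone0.
- rewrite big_cat big_map /= !big_cons big_nil /= -mulr_suml s1 mul1r.
  by rewrite addr0 addrA subrr add0r.
move=> t; rewrite big_cat big_map /= !big_cons big_nil /= !ffunE sz.
rewrite mulr0 !addr0 mulrBl mulr_suml; congr (_ + _); last by rewrite mulNr mulrC.
by apply: eq_bigr => w _; exact: mulrAC.
Qed.

(** Let e tend to 0: a weak linear inequality passes to the limit. *)
Lemma rational_cone_closed x y : (forall e, 0 < e -> K (shift x e y)) -> K x.
Proof.
case: rK => s -> h c cs.
pose L (z : {ffun T -> R}) : R := \sum_t (c t)%:~R * z t.
have iL : intfun L by exists c.
rewrite -/(L x) leNgt; apply/negP => Lx.
have [e e0 he] := small_perturbation [:: tt] (fun=> - L x) (fun=> - L y).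
have := he tt (mem_head _ _); rewrite oppr_gt0 => /(_ Lx).
rewrite mulrN -opprD oppr_gt0 -(intfun_shift _ _ _ iL) ltNge.
by rewrite /L h.
Qed.

End RationalConeTheory.

End RationalCones.

(** * The cone sigma(K) and its relative interior *)

Section ConeOfSigma.
Variables (R : realType) (n : nat) (A0 : pindex n).
Implicit Types (a b : Theta R n) (S x y : Xi R n).
Notation sK := (@sigma R n @` @coneK R n).

(** As in [strictK], the case j = i + 1 is inequality (a). *)
Definition slack a i j : R :=
  entry a i j.+1 + entry a i.+1 j - (entry a i j + entry a i.+1 j.+1).

Lemma coneKP a : coneK a <->
  forall i j, (i < j)%N -> (j.+1 < n)%N -> 0 <= slack a i j.
Proof.
split=> [[h1 h2] i j|h].
  rewrite leq_eqVlt => /orP[/eqP<-|ij] jn; rewrite subr_ge0; last exact: h2.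
  by rewrite entry_diag addr0; exact: h1.
split=> [i i2n|i j ij jn].
  by have := h i i.+1 (ltnSn i) i2n; rewrite subr_ge0 entry_diag addr0.
by have := h i j (ltnW ij) jn; rewrite subr_ge0.
Qed.

Lemma strictKP a : strictK a <->
  forall i j, (i < j)%N -> (j.+1 < n)%N -> 0 < slack a i j.
Proof.
by split=> h i j ij jn; [rewrite subr_gt0|rewrite -subr_gt0]; exact: h.
Qed.

Lemma intfun_entry i j : intfun (fun a : Theta R n => entry a i j).
Proof. by apply: intfun_sum => p; exact: intfun_coord. Qed.

Lemma intfun_slack i j : intfun (fun a : Theta R n => slack a i j).
Proof.
apply: intfunD; first by apply: intfunD; exact: intfun_entry.
by apply: intfunN; apply: intfunD; exact: intfun_entry.
Qed.

Lemma intfun_entry_unsigma i j : intfun (fun x => entry (unsigma A0 x) i j).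
Proof.
apply: intfun_sum => p.
apply: intfun_ext (intfun_coord R (pindex_iset A0 (val p).1 (val p).2)) => x.
by rewrite ffunE.
Qed.

Lemma intfun_slack_unsigma i j : intfun (fun x => slack (unsigma A0 x) i j).
Proof.
apply: intfunD; first by apply: intfunD; exact: intfun_entry_unsigma.
by apply: intfunN; apply: intfunD; exact: intfun_entry_unsigma.
Qed.

(** These functionals cut out the image of sigma. *)
Definition defect (A : pindex n) x : R := x A - sigma (unsigma A0 x) A.

Lemma intfun_defect A : intfun (defect A).
Proof.
apply: intfunD; first exact: intfun_coord.
apply: intfunN; apply: (@intfun_ext _ _ (fun x =>
  \sum_(r < #|val A|) entry (unsigma A0 x) r (elt (val A) r))).
  by move=> x; rewrite sigmaE.
by apply: intfun_sum => r; exact: intfun_entry_unsigma.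
Qed.

Lemma defect_sigma A a : defect A (sigma a) = 0.
Proof. by rewrite /defect unsigmaK subrr. Qed.

Lemma defect0 x : (forall A, defect A x = 0) -> x = sigma (unsigma A0 x).
Proof. by move=> h; apply/ffunP=> A; apply/eqP; rewrite -subr_eq0; apply/eqP/h. Qed.

Lemma sigma_shift a e b : sigma (shift a e b) = shift (sigma a) e (sigma b).
Proof.
apply/ffunP=> A; rewrite [RHS]ffunE !sigmaE mulr_sumr -big_split.
by apply: eq_bigr => r _; exact: (intfun_shift _ _ _ (intfun_entry _ _)).
Qed.

Lemma sigma_coneE : sK = [set x | (forall A, defect A x = 0) /\
  forall i j, (i < j)%N -> (j.+1 < n)%N -> 0 <= slack (unsigma A0 x) i j].
Proof.
apply/seteqP; split => x /=.
  case=> a /coneKP Ka <-; split=> [A|]; first exact: defect_sigma.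
  by rewrite unsigmaK.
case=> d0 h; exists (unsigma A0 x); first exact/coneKP.
by rewrite -defect0.
Qed.

Lemma rational_sigma_cone : rational_cone sK.
Proof.
pose L (k : pindex n * bool + 'I_n * 'I_n) x : R := match k with
  | inl (A, b) => (if b then 1 else -1) * defect A x
  | inr (i, j) => if (i < j)%N && (j.+1 < n)%N then slack (unsigma A0 x) i j else 0
  end.
have iL k : intfun (L k).
  case: k => [[A []]|[i j]].
  - by apply: intfun_ext (intfun_defect A) => x; rewrite /L mul1r.
  - by apply: intfun_ext (intfunN (intfun_defect A)) => x; rewrite /L mulN1r.
  have [ij|ij] := boolP ((i < j)%N && (j.+1 < n)%N).
    by apply: intfun_ext (intfun_slack_unsigma i j) => x; rewrite /L ij.
  by apply: intfun_ext (intfun0 _ _) => x; rewrite /L (negPf ij).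
rewrite sigma_coneE; suff -> : [set x | (forall A, defect A x = 0) /\
  forall i j, (i < j)%N -> (j.+1 < n)%N -> 0 <= slack (unsigma A0 x) i j] =
  [set x | forall k, 0 <= L k x] by exact: rational_cone_intfun.
apply/seteqP; split => x /=.
  case=> d0 h [[A b]|[i j]] /=; first by rewrite d0 mulr0.
  by case: ifP => // /andP[ij jn]; exact: h.
move=> h; split=> [A|i j ij jn].
  apply/eqP; rewrite eq_le -oppr_ge0.
  by have := h (inl (A, true)); have := h (inl (A, false)); rewrite /= mul1r mulN1r => -> ->.
by have := h (inr (Ordinal (ltn_trans ij (ltnW jn)), Ordinal (ltnW jn))); rewrite /= ij jn.
Qed.

(** A convex function of j - i, hence a point of the interior of K. *)
Definition square_dist : Theta R n := [ffun p : pos n => ((val p).2 - (val p).1)%N%:R ^+ 2].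

Lemma entry_square_dist i j : (i <= j < n)%N -> entry square_dist i j = (j - i)%N%:R ^+ 2.
Proof.
case/andP; rewrite leq_eqVlt => /orP[/eqP<- _|ij jn].
  by rewrite entry_diag subnn expr0n.
by rewrite (entry_mkpos _ ij jn) ffunE.
Qed.

Lemma strictK_square_dist : strictK square_dist.
Proof.
move=> i j ij jn; rewrite !entry_square_dist; try lia.
have -> : (j.+1 - i = (j - i.+1).+2)%N by lia.
have -> : (j.+1 - i.+1 = (j - i.+1).+1)%N by lia.
have -> : (j - i = (j - i.+1).+1)%N by lia.
move: (j - i.+1)%N => k; rewrite -[k.+2]addn2 -[k.+1]addn1 !natrD.
by have : (0 : R) <= k%:R by []; lra.
Qed.

Lemma strictK_coneK a : strictK a -> coneK a.
Proof. by move/strictKP=> h; apply/coneKP => i j ij jn; apply/ltW/h. Qed.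

Lemma affine_hull_sigma y : affine_hull sK y -> y = sigma (unsigma A0 y).
Proof.
case=> s [sKs _ ys]; apply: defect0 => A.
rewrite (intfun_lin (intfun_defect A) ys) big_seq big1 // => e /sKs[a _ <-].
by rewrite defect_sigma mulr0.
Qed.

(** From a point of the relative interior one can move slightly away from the
    interior point [square_dist], so no defining inequality is an equality. In
    the other direction, a point near sigma(a) in the affine hull of the cone is
    the image of a point near a. *)
Lemma relint_sigma_cone : relint sK = [set sigma a | a in @strictK R n].
Proof.
apply/seteqP; split => [x [[a Ka <-] [eps eps0 h]]|_ [a sa <-]] /=.
  exists a => //; apply/strictKP => i j ij jn.
  pose b := square_dist.
  have [e e0 he] := small_perturbation (enum {: pindex n})
    (fun=> eps) (fun A => - `|sigma a A - sigma b A|).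
  (* Slightly beyond sigma a, as seen from sigma b. *)
  pose y := shift (sigma a) e (shift (sigma a) (-1) (sigma b)).
  have Ky : sK y.
    apply: h => [|A].
      exists [:: (1 + e, sigma a); (- e, sigma b)]; split.
      - move=> w; rewrite !inE => /orP[]/eqP-> /=; first by exists a.
        by exists b => //; apply: strictK_coneK; exact: strictK_square_dist.
      - by rewrite !big_cons big_nil /=; ring.
      by move=> A; rewrite !big_cons big_nil !ffunE /=; ring.
    have := he A (mem_enum _ _) eps0; rewrite mulrN subr_gt0.
    by rewrite !shiftE addrAC subrr add0r mulN1r normrM (gtr0_norm e0).
  move: Ky; rewrite sigma_coneE => -[_ /(_ i j ij jn)].
  rewrite (intfun_shift _ _ _ (intfun_slack_unsigma i j)).
  rewrite (intfun_shift _ _ _ (intfun_slack_unsigma i j)) !unsigmaK.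
  have /strictKP/(_ i j ij jn) := strictK_square_dist.
  rewrite -/b; move: (slack a i j) (slack b i j) => u v v0.
  move=> hu; rewrite ltNge; apply/negP => u0.
  have h1 : 0 < e * v by exact: mulr_gt0.
  have h2 : e * u <= 0 by exact: mulr_ge0_le0 (ltW e0) u0.
  by lra.
split; first by exists a => //; exact: strictK_coneK.
pose r := [seq k : 'I_n * 'I_n <- enum {: 'I_n * 'I_n} | (k.1 < k.2)%N && (k.2.+1 < n)%N].
(* The constant 4: a slack involves four entries, each off by at most e. *)
have [e e0 he] := small_perturbation r (fun k : 'I_n * 'I_n => slack a k.1 k.2) (fun=> -4).
exists e => // y /affine_hull_sigma ey ye; rewrite ey; exists (unsigma A0 y) => //.
apply/coneKP => i j ij jn.
have close k l : `|entry (unsigma A0 y) k l - entry a k l| <= e.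
  have [/andP[kl ln]|kl] := boolP (k < l < n)%N; last first.
    by rewrite !entry_out // subrr normr0 ltW.
  rewrite !(entry_mkpos _ kl ln) -{1}(unsigmaK A0 a) [unsigma A0 y _]ffunE.
  rewrite [unsigma A0 (sigma a) _]ffunE.
  by apply/ltW; exact: ye.
have jn' := ltnW jn.
have kr : (Ordinal (ltn_trans ij jn'), Ordinal jn') \in r.
  by rewrite mem_filter /= ij jn mem_enum.
have /strictKP/(_ i j ij jn) sl := sa.
have := he _ kr sl; rewrite /slack /=.
have := close i j; have := close i j.+1; have := close i.+1 j; have := close i.+1 j.+1.
rewrite !ler_norml => /andP[h1 h1'] /andP[h2 h2'] /andP[h3 h3'] /andP[h4 h4'].
by lra.
Qed.

End ConeOfSigma.

(** * Tropical cones containing sigma(K) *)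

Section Maximality.
Variables (R : realType) (n : nat) (A0 : pindex n).
Implicit Types (a : Theta R n) (S : Xi R n) (m : pmonom n).
Notation sK := (@sigma R n @` @coneK R n).

Lemma groebner_class_toric S : Xi0 S -> init_ideal S = @toric R n ->
  groebner_class S = relint sK.
Proof.
move=> S0 IS; rewrite (relint_sigma_cone R A0).
apply/seteqP; split => [S' [S0' IS']|_ [a sa <-]] /=; last first.
  by split; [exact: sigma_Xi0|rewrite init_ideal_sigma].
rewrite IS in IS'.
have eS := grad_const_sigma A0 S0' (toric_grad_const IS').
exists (unsigma A0 S') => //; apply: strictK_of_init_ideal.
by rewrite -eS.
Qed.

Lemma trop_cone_sigma : trop_cone sK.
Proof.
have s0 := @strictK_square_dist R n; have I0 := init_ideal_sigma s0.
have rK := groebner_class_toric (sigma_Xi0 _) I0.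
split.
  split; first by move=> _ [a _ <-]; exact: sigma_Xi0.
    exact: (rational_sigma_cone R A0).
  by exists (sigma (square_dist R n)); [exact: sigma_Xi0|].
move=> S; rewrite -rK => -[_ ->]; rewrite I0; exact: toric_monomial_free.
Qed.

Lemma grad_shift S e S' m : grad (shift S e S') m = grad S m + e * grad S' m.
Proof.
rewrite /grad mulr_sumr -big_split; apply: eq_bigr => A _.
by rewrite shiftE mulrnDl mulrnAr.
Qed.

(** Perturbing S by e S' preserves the strict inequalities between grades for
    small e, and breaks the tie between m and s. *)
Lemma init_part_perturbed S S' f m s : grad S' m < grad S' s ->
  f@_m != 0 -> f@_s != 0 ->
  {in msupp f, forall t, grad S m <= grad S t} ->
  {in msupp f, forall t, t != m -> t != s -> grad S m < grad S t} ->
  exists2 e, 0 < e & init_part (shift S e S') f = f@_m *: 'X_[m].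
Proof.
move=> lt_ms fm fs min_m min_t.
have [e e0 he] := small_perturbation (msupp f)
  (fun t => grad S t - grad S m) (fun t => grad S' t - grad S' m).
exists e => //; pose Se := shift S e S'.
have lt_m t : t \in msupp f -> t != m -> grad Se m < grad Se t.
  move=> tf tm; rewrite /Se !grad_shift; have [->|ts] := eqVneq t s.
    apply: ler_ltD; last by rewrite ltr_pM2l.
    by apply: min_m; rewrite mcoeff_msupp.
  have := he t tf; rewrite subr_gt0 => /(_ (min_t t tf tm ts)).
  by rewrite mulrBr addrACA -opprD subr_gt0.
have mf : m \in msupp f by rewrite mcoeff_msupp.
apply/mpolyP=> t; rewrite mcoeff_init mcoeffZ mcoeffX.
have [<-|mt] := eqVneq m t.
  rewrite mulr1 ifT //; apply/allP => t' t'f.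
  by have [->|t'm] := eqVneq t' m; rewrite // ltW // lt_m.
rewrite mulr0; case: ifP => // /allP/(_ m mf) le_tm.
apply/memN_msupp_eq0/negP => tf.
by have := lt_m t tf; rewrite eq_sym mt ltNge le_tm => /(_ isT).
Qed.

(** Each monomial is joined to a standard one by a binomial with a lift to I; by
    [init_part_perturbed], S' takes the same value on both. *)
Lemma perturbed_grad_const a S' : strictK a ->
  (forall e, 0 < e -> monomial_free (init_ideal (shift (sigma a) e S'))) ->
  forall m s, samekey m s -> grad S' m = grad S' s.
Proof.
move=> sa mfree.
have step m s : samekey m s -> forall f : pring R n, pideal f ->
    init_part (sigma a) f = 'X_[m] - 'X_[s] -> grad S' m = grad S' s.
  move=> ms f If ef.
  have [->//|mNs] := eqVneq m s.
  have coefE t : (init_part (sigma a) f)@_t = (m == t)%:R - (s == t)%:R.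
    by rewrite ef mcoeffB !mcoeffX.
  have minP t : t \in msupp f ->
      all (fun t' => grad (sigma a) t <= grad (sigma a) t') (msupp f) = (t == m) || (t == s).
    move=> tf; have := coefE t; rewrite mcoeff_init !(eq_sym _ t).
    move: tf; rewrite mcoeff_msupp; case: ifP => _ ft.
      case: eqP => // _; case: eqP => // _ /eqP.
      by rewrite subrr (negPf ft).
    have [->|_] := eqVneq t m.
      by rewrite (negPf mNs) subr0 => /esym/eqP; rewrite oner_eq0.
    have [_|//] := eqVneq t s.
    by rewrite sub0r => /esym/eqP; rewrite oppr_eq0 oner_eq0.
  have nz t : (m == t) != (s == t) -> f@_t != 0.
    apply: contraNneq => ft; have := coefE t; rewrite mcoeff_init ft if_same.
    move/esym/eqP; case: (m == t); case: (s == t) => //;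
    by rewrite ?subr0 ?sub0r ?oppr_eq0 oner_eq0.
  have fm : f@_m != 0 by apply: nz; rewrite eqxx (eq_sym s) (negPf mNs).
  have fs : f@_s != 0 by apply: nz; rewrite eqxx (negPf mNs).
  have mf : m \in msupp f by rewrite mcoeff_msupp.
  have sf : s \in msupp f by rewrite mcoeff_msupp.
  have min_m : {in msupp f, forall t, grad (sigma a) m <= grad (sigma a) t}.
    by apply/allP; rewrite minP ?eqxx.
  have min_s : {in msupp f, forall t, grad (sigma a) s <= grad (sigma a) t}.
    by apply/allP; rewrite minP ?eqxx ?orbT.
  have min_t : {in msupp f, forall t, t != m -> t != s ->
      grad (sigma a) m < grad (sigma a) t}.
    move=> t tf tm ts; rewrite lt_neqAle min_m // andbT; apply/eqP => e.
    have := minP t tf; rewrite (negPf tm) (negPf ts) /= => /negP; apply.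
    by apply/allP => t' /min_m; rewrite e.
  have grad_ms : grad (sigma a) m = grad (sigma a) s.
    by apply/eqP; rewrite eq_le min_m // min_s.
  have contra t e : 0 < e -> f@_t != 0 ->
      init_part (shift (sigma a) e S') f = f@_t *: 'X_[t] -> False.
    move=> e0 ft ei; apply: (mfree e e0 t).
    rewrite -['X_[t]]scale1r -(mulVf ft) -scalerA -ei -[_ *: init_part _ _]addr0.
    by apply: init_ideal_lin; [exact: init_ideal_init|exact: init_ideal0].
  case: (ltgtP (grad S' m) (grad S' s)) => // lt; exfalso.
    have [e e0] := init_part_perturbed lt fm fs min_m min_t.
    exact: contra.
  have [|e e0] := init_part_perturbed lt fs fm min_s.
    by move=> t tf ts tm; rewrite -grad_ms; exact: min_t.
  exact: contra.
have red m : exists s, [/\ standard s, samekey m s & grad S' m = grad S' s].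
  have [s [ss ms lift_ms]] := init_straightening m sa; exists s; split=> //.
  by case: lift_ms => [->//|[f If]]; exact: step.
move=> m m' mm'; have [s [ss ms ->]] := red m; have [s' [ss' ms' ->]] := red m'.
suff -> : s = s' by [].
have : samekey s s'.
  by apply: samekey_trans (samekey_trans mm' ms'); rewrite samekey_sym.
by case/andP=> /eqP ed /eqP et; exact: standard_key_inj.
Qed.

Lemma strictK_shift a b : strictK a -> exists2 e, 0 < e & strictK (shift a e b).
Proof.
move/strictKP=> sa.
pose r := [seq k : 'I_n * 'I_n <- enum {: 'I_n * 'I_n} | (k.1 < k.2)%N && (k.2.+1 < n)%N].
have [e e0 he] := small_perturbation r
  (fun k : 'I_n * 'I_n => slack a k.1 k.2) (fun k : 'I_n * 'I_n => slack b k.1 k.2).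
exists e => //; apply/strictKP => i j ij jn.
rewrite (intfun_shift _ _ _ (intfun_slack _ _ _ _)).
have jn' := ltnW jn.
apply: (he (Ordinal (ltn_trans ij jn'), Ordinal jn')); last exact: sa.
by rewrite mem_filter /= ij jn mem_enum.
Qed.

(** Both cones are the closures of their relative interiors, which are the class
    of sigma(a) + e S' for small e. *)
Lemma trop_cone_sigma_max K' : trop_cone K' -> sK `<=` K' -> K' = sK.
Proof.
move=> [[K'0 rK' [S' S'0 relK']] mf] sub.
pose a0 := square_dist R n; have sa0 : strictK a0 := @strictK_square_dist R n.
have Ka0 : K' (sigma a0) by apply: sub; exists a0 => //; exact: strictK_coneK.
have relS' : relint K' S' by rewrite relK'; split.
have rel_shift x e : K' x -> 0 < e -> relint K' (shift x e S').
  by move=> Kx e0; exact: relint_shift.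
have gconst := perturbed_grad_const sa0 (fun e e0 => mf _ (rel_shift _ e Ka0 e0)).
have eS' := grad_const_sigma A0 S'0 gconst.
have [e e0 se] := strictK_shift (unsigma A0 S') sa0.
have : relint K' (shift (sigma a0) e S') by exact: rel_shift.
rewrite {1}eS' -sigma_shift relK' => -[_]; rewrite init_ideal_sigma // => IS'.
have rel_eq : relint K' = relint sK.
  by rewrite relK'; apply: groebner_class_toric.
apply/seteqP; split=> // x Kx.
apply: (rational_cone_closed (rational_sigma_cone R A0) (y := S')) => e' e'0.
by have : relint sK (shift x e' S') by [rewrite -rel_eq; exact: rel_shift]; case.
Qed.

End Maximality.

Theorem theorem6p2 (R : realType) (n : nat) (hn : (2 <= n)%N) :
  groebner_cone (@sigma R n @` @coneK R n) /\
  maximal_trop_cone (@sigma R n @` @coneK R n).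
Proof.
have A0 : pindex n.
  have c : (0 < #|iset n 0 0| < n)%N by rewrite card_iset // (ltnW hn).
  exact: pindex_of c.
have tropK := trop_cone_sigma R A0.
by split; [case: tropK|split; [|exact: trop_cone_sigma_max]].
Qed.
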